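(* Let $R$ be an associative ring with $1$ and let $T$ be the complete first-order theory of the free left $R$-modules of infinite rank. The following are equivalent. (i) For some infinite cardinal $\kappa$ (equivalently, for every infinite cardinal $\kappa$), $R^{(\kappa)}$ is $\prec$-universal (equivalently, pure-universal) among the $\kappa$-generated flat models of $T$. (ii) For some infinite cardinal $\kappa$ (equivalently, for every infinite cardinal $\kappa$), $R^{(\kappa)}$ is pure-universal among the $\kappa$-generated flat left $R$-modules. (iii) $R$ is left perfect. Moreover, ''pure-universal'' may be replaced by ''direct-summand-universal'' in these conditions.
   Context: Modules are unitary left $R$-modules unless stated otherwise. $L$ is the first-order language of left $R$-modules with $0,+$ and a unary function symbol for each element of $R$. $R^{(\kappa)}$ is the free left $R$-module of rank $\kappa$ (the direct sum of $\kappa$ copies of ${}_RR$). All free left $R$-modules of infinite rank are elementarily equivalent, so their common $L$-theory $T$ is complete. A module is $\kappa$-generated if it has a generating set of cardinality at most $\kappa$. A pp formula is an existentially quantified finite conjunction of $R$-linear equations; an embedding $M\to N$ is pure if, after identifying $M$ with its image, $\varphi(N)\cap M^n=\varphi(M)$ for every pp formula $\varphi$ (in $n$ free variables, for every $n$). A module $U$ is pure-universal (resp. $\prec$-universal, direct-summand-universal) among the members of a class $\mathcal K$ if every member of $\mathcal K$ of cardinality at most $|U|$ has a pure embedding (resp. an elementary embedding, an embedding as a direct summand) into $U$. $R$ is left perfect if every flat left $R$-module is projective. *)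

(* Defs.v *)
From HB Require Import structures.
From mathcomp Require Import all_boot all_algebra.
From mathcomp Require Import boolp classical_sets functions cardinality.

Set Implicit Arguments.
Unset Strict Implicit.
Unset Printing Implicit Defensive.

Import GRing.Theory.

Local Open Scope ring_scope.
Local Open Scope card_scope.
Local Open Scope classical_set_scope.

(* Rings are associative with 1 and may be zero (pzRingType); a right R-module
   is a left module over the converse ring R^c.  Cardinals are represented by
   types: the cardinal of I is |[set: I]|. *)

(** * Free modules *)

Definition finitely_supported (R : pzRingType) (I : Type) : {pred I -> R^o} :=
  fun f => `[< finite_set [set i | f i <> 0] >].
Arguments finitely_supported R I : clear implicits.

(* R^(I), as the submodule of the product R^I of finitely supported families *)
Record freemod (R : pzRingType) (I : Type) : Type := Freemod {
  freemod_val :> I -> R^o ;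
  freemod_valP : freemod_val \in finitely_supported R I }.

HB.instance Definition _ (R : pzRingType) (I : Type) :=
  [isSub for @freemod_val R I].
HB.instance Definition _ (R : pzRingType) (I : Type) :=
  [Choice of freemod R I by <:].

Lemma finitely_supported_submod (R : pzRingType) (I : Type) :
  submod_closed (finitely_supported R I).
Proof.
split; first by apply/asboolP; rewrite (_ : mkset _ = set0)//; apply/seteqP; split.
move=> a f g /asboolP ff /asboolP fg; apply/asboolP.
apply: (@sub_finite_set _ _ ([set i | f i <> 0] `|` [set i | g i <> 0])).
  move=> i /= afg; have [f0|] := pselect (f i = 0); last by left.
  by right => g0; apply: afg; rewrite !fctE f0 g0 scaler0 addr0.
by rewrite finite_setU.
Qed.

HB.instance Definition _ (R : pzRingType) (I : Type) :=
  GRing.isSubmodClosed.Build R (I -> R^o) (finitely_supported R I)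
    (finitely_supported_submod R I).
HB.instance Definition _ (R : pzRingType) (I : Type) :=
  [SubChoice_isSubLmodule of freemod R I by <:].

(** * First-order logic of left R-modules *)

(* Terms and formulas are indexed by the number of free variables; the
   quantifiers bind variable 0 of a formula in n.+1 variables. *)
Inductive term (R : Type) (n : nat) : Type :=
| tVar of 'I_n
| tZero
| tAdd of term R n & term R n
| tScale of R & term R n.

Inductive formula (R : Type) : nat -> Type :=
| fEq n of term R n & term R n : formula R n
| fNot n of formula R n : formula R n
| fAnd n of formula R n & formula R n : formula R n
| fOr n of formula R n & formula R n : formula R n
| fImp n of formula R n & formula R n : formula R n
| fAll n of formula R n.+1 : formula R n
| fEx n of formula R n.+1 : formula R n.

Fixpoint eval (R : pzRingType) (M : lmodType R) (n : nat) (v : 'I_n -> M)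
    (t : term R n) : M :=
  match t with
  | tVar i => v i
  | tZero => 0
  | tAdd t u => eval v t + eval v u
  | tScale r t => r *: eval v t
  end.

Definition extend (M : Type) (n : nat) (x : M) (v : 'I_n -> M) : 'I_n.+1 -> M :=
  fun i => oapp v x (unlift ord0 i).

Fixpoint sat (R : pzRingType) (M : lmodType R) (n : nat) (phi : formula R n) :
    ('I_n -> M) -> Prop :=
  match phi with
  | fEq _ t u => fun v => eval v t = eval v u
  | fNot _ p => fun v => ~ sat p v
  | fAnd _ p q => fun v => sat p v /\ sat q v
  | fOr _ p q => fun v => sat p v \/ sat q v
  | fImp _ p q => fun v => sat p v -> sat q v
  | fAll _ p => fun v => forall x : M, sat p (extend x v)
  | fEx _ p => fun v => exists x : M, sat p (extend x v)
  end.

(* satisfaction of sentences; the (empty) assignment is immaterial *)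
Definition models (R : pzRingType) (M : lmodType R) (phi : formula R 0) : Prop :=
  sat phi (fun=> 0 : M).

(* the common theory of the free modules of infinite rank *)
Definition free_theory (R : pzRingType) : set (formula R 0) :=
  [set phi | forall I : Type, infinite_set [set: I] -> models (freemod R I) phi].
Arguments free_theory R : clear implicits.

Definition model_of (R : pzRingType) (Th : set (formula R 0)) (M : lmodType R) :
    Prop :=
  forall phi, Th phi -> models M phi.

Fixpoint eq_conj (R : Type) (n : nat) (phi : formula R n) : bool :=
  match phi with
  | fEq _ _ _ => true
  | fAnd _ p q => eq_conj p && eq_conj q
  | _ => false
  end.

Fixpoint pp (R : Type) (n : nat) (phi : formula R n) : bool :=
  match phi with
  | fEx _ p => pp p
  | _ => eq_conj phi
  end.

(** * Embeddings and universality *)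

Definition elementary_embedding (R : pzRingType) (M N : lmodType R)
    (f : {linear M -> N}) : Prop :=
  forall (n : nat) (phi : formula R n) (v : 'I_n -> M),
    sat phi (f \o v) <-> sat phi v.

Definition pure_embedding (R : pzRingType) (M N : lmodType R)
    (f : {linear M -> N}) : Prop :=
  injective f /\
  forall (n : nat) (phi : formula R n) (v : 'I_n -> M),
    pp phi -> (sat phi (f \o v) <-> sat phi v).

(* N is the internal direct sum of f(M) and a submodule C *)
Definition summand_embedding (R : pzRingType) (M N : lmodType R)
    (f : {linear M -> N}) : Prop :=
  injective f /\
  exists C : {pred N},
    [/\ submod_closed C,
        forall y, exists x c, c \in C /\ y = f x + c
      & forall x, f x \in C -> f x = 0].

Definition universal (R : pzRingType)
    (emb : forall M N : lmodType R, {linear M -> N} -> Prop)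
    (K : lmodType R -> Prop) (U : lmodType R) : Prop :=
  forall M : lmodType R, K M -> [set: M] #<= [set: U] ->
    exists f : {linear M -> U}, emb M U f.

(** * Flat and projective modules, perfect rings *)

(* Elements of A (x)_R M are finite formal sums of pairs (a, m), up to the
   following congruence.  The commutative monoid so presented is the tensor
   product: it is already a group, the opposite of (a, m) being (- a, m). *)
Inductive tensor_eq (R : pzRingType) (A : lmodType R^c) (M : lmodType R) :
    seq (A * M) -> seq (A * M) -> Prop :=
| tensor_refl s : tensor_eq s s
| tensor_sym s t : tensor_eq s t -> tensor_eq t s
| tensor_trans s t u : tensor_eq s t -> tensor_eq t u -> tensor_eq s u
| tensor_cat s s' t t' :
    tensor_eq s s' -> tensor_eq t t' -> tensor_eq (s ++ t) (s' ++ t')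
| tensor_catC s t : tensor_eq (s ++ t) (t ++ s)
| tensor_0l m : tensor_eq [:: (0, m)] [::]
| tensor_Dl a b m : tensor_eq [:: (a + b, m)] [:: (a, m); (b, m)]
| tensor_Dr a m n : tensor_eq [:: (a, m + n)] [:: (a, m); (a, n)]
| tensor_balanced a (r : R) m :
    tensor_eq [:: ((r : R^c) *: a, m)] [:: (a, r *: m)].

Definition tensor_map (R : pzRingType) (A B : lmodType R^c) (M : lmodType R)
    (f : {linear A -> B}) (s : seq (A * M)) : seq (B * M) :=
  [seq (f p.1, p.2) | p <- s].

(* - (x)_R M preserves injectivity *)
Definition flat (R : pzRingType) (M : lmodType R) : Prop :=
  forall (A B : lmodType R^c) (f : {linear A -> B}), injective f ->
    forall s t : seq (A * M),
      tensor_eq (tensor_map f s) (tensor_map f t) -> tensor_eq s t.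

Definition projective (R : pzRingType) (P : lmodType R) : Prop :=
  forall (A B : lmodType R) (f : {linear A -> B}) (g : {linear P -> B}),
    (forall b, exists a, f a = b) ->
    exists h : {linear P -> A}, forall x, f (h x) = g x.

Definition left_perfect (R : pzRingType) : Prop :=
  forall M : lmodType R, flat M -> projective M.

(** * Generation *)

Definition generates (R : pzRingType) (M : lmodType R) (S : set M) : Prop :=
  forall P : {pred M}, submod_closed P ->
    (forall x, S x -> x \in P) -> forall x, x \in P.

Definition generated_by_card (R : pzRingType) (I : Type) (M : lmodType R) :
    Prop :=
  exists S : set M, S #<= [set: I] /\ generates S.

Definition generated_flat (R : pzRingType) (I : Type) (M : lmodType R) : Prop :=
  generated_by_card I M /\ flat M.

Definition generated_flat_model (R : pzRingType) (I : Type) (M : lmodType R) :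
    Prop :=
  [/\ generated_by_card I M, flat M & model_of (free_theory R) M].

(* Main.v *)
(* Write F for the free module of countable rank.  By the equational criterion, M is
   flat iff every linear map z : F -> M killing u factors through an endomorphism
   of F killing u.

   (i) => (iii).  A sequence of endomorphisms of F has a flat colimit G, and
   G (+) R^(I) is a model of T: in flat modules with enough room for free direct
   summands every formula is equivalent to a Boolean combination of positive
   primitive ones, depending on R only.  The images in G of finitely many elements of
   F lie in a finite rank free direct summand of R^(I) under a pure embedding of
   G (+) R^(I); pulling this back by purity shows that the sequence stabilizes on
   these elements.  So the finitely generated right submodules of R^n that arise
   from representations of a tuple of a flat module M by linear combinations
   satisfy a descending chain condition.  Given a submodule N with M/N flat, minimal
   representations chosen successively span modulo N a countably generated pure
   submodule that is a Mittag-Leffler colimit of finite rank free modules, hence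
   projective; so a partial lift of a map from M, defined on N, extends to it.
   Zorn's lemma then shows that M is projective.

   (iii) => (i), (ii).  A projective module with I generators is a direct summand of
   R^(I); if it is a model of T, the quantifier elimination makes the embedding
   elementary. *)

Require Import Defs.
From HB Require Import structures.
From mathcomp Require Import all_boot all_algebra.
From mathcomp Require Import boolp classical_sets functions cardinality.

Set Implicit Arguments.
Unset Strict Implicit.
Unset Printing Implicit Defensive.

Import GRing.Theory.

Local Open Scope classical_set_scope.
Local Open Scope ring_scope.

(** * Free modules *)

Section FreeModules.
Variable R : pzRingType.

Lemma linearPD (M N : lmodType R) (f : {linear M -> N}) a x y :
  f (a *: x + y) = a *: f x + f y.
Proof. by rewrite linearD linearZ. Qed.

Definition mklin (M N : lmodType R) (f : M -> N) (H : linear f) :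
  {linear M -> N} := HB.pack_for {linear M -> N} f (GRing.isLinear.Build _ _ _ _ _ H).

Section Basis.
Variable K : Type.
Local Notation F := (freemod R K).

Lemma freemodE (x y : F) : (forall k, x k = y k) -> x = y.
Proof. by move=> h; apply/val_inj/funext. Qed.

Lemma freemodD (x y : F) k : (x + y) k = x k + y k. Proof. by []. Qed.
Lemma freemodZ a (x : F) k : (a *: x) k = a * x k. Proof. by []. Qed.
Lemma freemod_sum I (r : seq I) (g : I -> F) k :
  (\sum_(i <- r) g i) k = \sum_(i <- r) g i k.
Proof. by elim/big_rec2: _ => [//|i y1 y2 _ <-]. Qed.

(** [{classic K}] is [K] with the equality test given by excluded middle, so that supports can be
    handled as duplicate-free sequences. *)
Lemma freemod_support (x : F) :
  exists2 s : seq {classic K}, uniq s & forall k : K, x k != 0 -> (k : {classic K}) \in s.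
Proof.
case: x => f /= /[dup] ff /asboolP /(finite_seqP (T := {classic K}))[s Es].
exists (undup s); first exact: undup_uniq.
by move=> k /eqP; rewrite mem_undup => xk; suff : [set` s] (k : {classic K}) by []; rewrite -Es.
Qed.

Lemma basis_subproof (k : K) :
  (fun i => (`[< i = k >] : nat)%:R : R^o) \in finitely_supported R K.
Proof.
apply/asboolP; apply: (sub_finite_set (B := [set k])); last exact: finite_set1.
by move=> i /=; case: asboolP.
Qed.

Definition fbasis (k : K) : F := Freemod (basis_subproof k).

Arguments fbasis : simpl never.

Lemma fbasisE k i : fbasis k i = (`[< i = k >] : nat)%:R. Proof. by []. Qed.
Lemma fbasis_eq k : fbasis k k = 1.
Proof. by rewrite fbasisE asboolT. Qed.
Lemma fbasis_neq k i : i <> k -> fbasis k i = 0.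
Proof. by move=> h; rewrite fbasisE asboolF. Qed.

Definition fsupp (x : F) : seq {classic K} := s2val (cid2 (freemod_support x)).
Lemma fsupp_uniq x : uniq (fsupp x). Proof. by rewrite /fsupp; case: cid2. Qed.
Lemma mem_fsupp (x : F) (k : K) : x k != 0 -> (k : {classic K}) \in fsupp x.
Proof. by rewrite /fsupp; case: cid2 => /= s _; apply. Qed.

Section Lift.
Variables (M : lmodType R) (y : K -> M).

Definition flift_fun (x : F) : M := \sum_(k <- fsupp x) (x k : R) *: y k.

(** Any sequence containing the support gives the same sum, so that several vectors can be summed
    over a common one. *)
Lemma flift_fun_supp (s : seq {classic K}) (x : F) : uniq s ->
  (forall k : K, x k != 0 -> (k : {classic K}) \in s) ->
  flift_fun x = \sum_(k <- s) (x k : R) *: y k.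
Proof.
move=> us hs; rewrite /flift_fun.
have nz (r : seq {classic K}) :
    \sum_(k <- r) (x k : R) *: y k = \sum_(k <- r | x k != 0) (x k : R) *: y k.
  rewrite [RHS]big_mkcond; apply: eq_bigr => k _.
  by case: eqP => //= ->; rewrite scale0r.
rewrite nz [RHS]nz -big_filter -[RHS]big_filter; apply/perm_big.
apply: uniq_perm; rewrite ?filter_uniq ?fsupp_uniq//.
by move=> k; rewrite !mem_filter; case: eqP => //= /eqP/[dup] /hs -> /mem_fsupp ->.
Qed.

Lemma flift_is_linear : linear flift_fun.
Proof.
move=> a u v; pose s := undup (fsupp u ++ fsupp v).
have us : uniq s by exact: undup_uniq.
have hs (x : F) (k : K) : (x == u) || (x == v) -> x k != 0 -> (k : {classic K}) \in s.
  by rewrite mem_undup mem_cat; case/orP=> /eqP -> /mem_fsupp ->; rewrite ?orbT.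
rewrite !(@flift_fun_supp s) // => [|k|k|k]; try by apply: hs; rewrite eqxx ?orbT.
  rewrite scaler_sumr -big_split; apply: eq_bigr => k _ /=.
  by rewrite scalerDl scalerA.
rewrite freemodD freemodZ; have [->|/hs -> //] := eqVneq (u k) 0; last by rewrite eqxx.
by rewrite mulr0 add0r; apply: hs; rewrite eqxx orbT.
Qed.

HB.instance Definition _ := GRing.isLinear.Build R F M *:%R flift_fun flift_is_linear.
Definition flift : {linear F -> M} := flift_fun.

Lemma flift_basis k : flift (fbasis k) = y k.
Proof.
rewrite /= (@flift_fun_supp [:: (k : {classic K})])//.
  by rewrite big_seq1 fbasis_eq scale1r.
by move=> i; rewrite inE; have [-> | /fbasis_neq ->] := pselect (i = k); rewrite eqxx.
Qed.

End Lift.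

Lemma freemod_sumE (s : seq {classic K}) (x : F) : uniq s ->
  (forall k : K, x k != 0 -> (k : {classic K}) \in s) ->
  x = \sum_(k <- s) (x k : R) *: fbasis k.
Proof.
move=> us hs; apply: freemodE => k; rewrite freemod_sum.
have hk (j : {classic K}) : (((x j : R) *: fbasis j) : F) k = if j == k then x k else 0.
  rewrite freemodZ; case: eqP => [->|nk]; first by rewrite fbasis_eq mulr1.
  by rewrite fbasis_neq ?mulr0// => ?; apply: nk.
rewrite (eq_bigr _ (fun j _ => hk j)) -big_mkcond /=.
have [ks|ks] := boolP ((k : {classic K}) \in s).
  by rewrite (big_rem _ ks) eqxx big_seq_cond big1 ?Monoid.mulm1// => j /andP[];
    rewrite mem_rem_uniq// inE => /andP[/negP].
rewrite big_seq_cond big1 => [|j /andP[js /eqP jk]]; last by rewrite -jk js in ks.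
by have [//|/hs xk] := eqVneq (x k) 0; rewrite xk in ks.
Qed.

Lemma freemod_lin_ext_on (M : lmodType R) (f g : {linear F -> M})
    (s : seq {classic K}) (x : F) : uniq s ->
  (forall k : K, (k : {classic K}) \in s -> f (fbasis k) = g (fbasis k)) ->
  (forall k : K, x k != 0 -> (k : {classic K}) \in s) -> f x = g x.
Proof.
move=> us fg /(freemod_sumE us) ->; rewrite !linear_sum big_seq [RHS]big_seq.
by apply: eq_bigr => k /fg; rewrite !linearZ_LR => ->.
Qed.

Lemma freemod_ind (P : F -> Prop) : P 0 ->
  (forall a k x, P x -> P (a *: fbasis k + x)) -> forall x, P x.
Proof.
move=> P0 PD x; have [s us hs] := freemod_support x.
rewrite (freemod_sumE us hs); elim: (s : seq _) => [|k r IH]; first by rewrite big_nil.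
by rewrite big_cons; apply: PD.
Qed.

Lemma freemod_lin_ext (M : lmodType R) (f g : {linear F -> M}) :
  (forall k, f (fbasis k) = g (fbasis k)) -> f =1 g.
Proof.
move=> h; apply: freemod_ind => [|a k x IH]; first by rewrite !linear0.
by rewrite !linearPD h IH.
Qed.

(** [P] is a submodule of the product of [F] and [M] that projects onto [F]; choosing values on the
    basis gives a linear section. *)
Lemma freemod_choice (M : lmodType R) (P : F -> M -> Prop) : P 0 0 ->
  (forall a x m y n, P x m -> P y n -> P (a *: x + y) (a *: m + n)) ->
  (forall x, exists m, P x m) ->
  exists f : {linear F -> M}, forall x, P x (f x).
Proof.
move=> P0 PD PT.
have [y Py] := choice (fun k => PT (fbasis k)).
exists (flift y); apply: freemod_ind => [|a k x IH]; first by rewrite linear0.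
by rewrite linearPD flift_basis; apply: PD.
Qed.

Lemma freemod_projective : projective F.
Proof.
move=> A B f g sf.
have [||x|h hP] := @freemod_choice A (fun x a => f a = g x); last by exists h.
- by rewrite !linear0.
- by move=> a x m y n hm hn; rewrite !linearPD hm hn.
- exact: sf.
Qed.

End Basis.
End FreeModules.
Arguments fbasis : simpl never.

(** * The free module of countable rank *)

Section CountableFree.
Variable R : pzRingType.
Local Notation F := (freemod R nat).
Local Notation e := (@fbasis R nat).

(* The image of [trunc n] in F serves as the free module of rank n. *)
Definition trunc (n : nat) : {linear F -> F} :=
  flift (fun i => if (i < n)%N then e i else 0).

Lemma truncE n (x : F) i : trunc n x i = if (i < n)%N then x i else 0.
Proof.
elim/freemod_ind: x => [|a k x IH]; first by rewrite linear0 if_same.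
rewrite linearPD flift_basis !(freemodD, freemodZ) IH.
case: (ltnP k n) => kn; first by case: ifP => // lin; rewrite fbasis_neq ?mulr0 ?addr0// => ik;
  rewrite ik kn in lin.
case: ifP => // lin; last by rewrite mulr0 add0r.
by rewrite fbasis_neq// => ik; move: lin; rewrite ik ltnNge kn.
Qed.

Lemma trunc_basis n i : (i < n)%N -> trunc n (e i) = e i.
Proof. by move=> lin; rewrite flift_basis lin. Qed.

Lemma trunc_id n (x : F) : (forall i, (n <= i)%N -> x i = 0) -> trunc n x = x.
Proof.
by move=> h; apply: freemodE => i; rewrite truncE; case: ltnP => // /h ->.
Qed.

Lemma trunc_trunc m n x : (n <= m)%N -> trunc m (trunc n x) = trunc n x.
Proof.
move=> nm; apply: trunc_id => i mi; rewrite truncE ltnNge.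
by rewrite (leq_trans nm mi).
Qed.

Lemma trunc_leq m n x : (n <= m)%N -> trunc n x = x -> trunc m x = x.
Proof. by move=> nm <-; apply: trunc_trunc. Qed.

Lemma trunc_ex (x : F) : exists n, trunc n x = x.
Proof.
elim/freemod_ind: x => [|a k x [n IH]]; first by exists 0%N; rewrite linear0.
exists (maxn k.+1 n); rewrite linearPD trunc_basis ?leq_maxl//.
by rewrite (trunc_leq _ IH)// leq_maxr.
Qed.

Lemma trunc_ex_family (x : nat -> F) N :
  exists n, forall i, (i < N)%N -> trunc n (x i) = x i.
Proof.
elim: N => [|N [n IH]]; first by exists 0%N.
have [m xm] := trunc_ex (x N); exists (maxn m n) => i; rewrite ltnS leq_eqVlt.
case/orP=> [/eqP->|/IH xi]; first exact: trunc_leq (leq_maxl _ _) xm.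
exact: trunc_leq (leq_maxr _ _) xi.
Qed.

Lemma trunc_sum n (x : F) : trunc n x = \sum_(i < n) (x i : R) *: e i.
Proof.
elim: n => [|n IH]; first by rewrite big_ord0; apply: freemodE => i; rewrite truncE.
rewrite big_ord_recr /= -IH; apply: freemodE => i.
rewrite freemodD freemodZ !truncE ltnS leq_eqVlt;  case: eqP => [->|ni].
  by rewrite ltnn add0r fbasis_eq mulr1.
by rewrite fbasis_neq// mulr0 addr0.
Qed.

Lemma trunc_lin_sum (M : lmodType R) n (f : {linear F -> M}) (x : F) :
  trunc n x = x -> f x = \sum_(i < n) (x i : R) *: f (e i).
Proof.
move=> {1}<-; rewrite trunc_sum linear_sum; apply: eq_bigr => i _.
exact: linearZ_LR.
Qed.

Lemma trunc_lin_ext (M : lmodType R) n (f g : {linear F -> M}) :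
  (forall i, (i < n)%N -> f (e i) = g (e i)) ->
  forall x, trunc n x = x -> f x = g x.
Proof.
move=> h x <-; rewrite trunc_sum !linear_sum; apply: eq_bigr => i _.
by rewrite !linearZ_LR h.
Qed.

Lemma trunc_image_ex (f : {linear F -> F}) n :
  exists m, forall x, trunc m (f (trunc n x)) = f (trunc n x).
Proof.
have [m hm] := trunc_ex_family (fun i => f (e i)) n; exists m => x.
have h (i : nat) : (i < n)%N -> (trunc m \o f) (e i) = f (e i) by exact: hm.
exact: (trunc_lin_ext (f := trunc m \o f) h (trunc_trunc x (leqnn n))).
Qed.

(** [evens] and [odds] embed two complementary copies of [F] in [F], so that [copair] merges two
    maps from [F] into one with the same source. *)
Definition evens : {linear F -> F} := flift (fun i => e i.*2).
Definition odds : {linear F -> F} := flift (fun i => e i.*2.+1).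
Definition copair (M : lmodType R) (f g : {linear F -> M}) : {linear F -> M} :=
  flift (fun i => (if odd i then g else f) (e i./2)).

Lemma copair_evens (M : lmodType R) (f g : {linear F -> M}) x : copair f g (evens x) = f x.
Proof.
apply: (freemod_lin_ext (f := copair f g \o evens)) => k /=.
by rewrite !flift_basis odd_double doubleK.
Qed.

Lemma copair_odds (M : lmodType R) (f g : {linear F -> M}) x : copair f g (odds x) = g x.
Proof.
apply: (freemod_lin_ext (f := copair f g \o odds)) => k /=.
by rewrite !flift_basis /= odd_double uphalf_double.
Qed.

(** * The equational criterion for flatness *)

(* The equational criterion for flatness of M/N, with linear maps from F in
   place of finite tuples. *)
Definition eqflat_mod (M : lmodType R) (N : set M) :=
  forall (z : {linear F -> M}) (u : F), N (z u) ->
  exists (S : {linear F -> F}) (z' : {linear F -> M}),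
    (forall x, N (z x - z' (S x))) /\ S u = 0.

Definition eqflat (M : lmodType R) := eqflat_mod [set 0 : M].

Lemma eqflatP (M : lmodType R) (z : {linear F -> M}) u : eqflat M -> z u = 0 ->
  exists (S : {linear F -> F}) (z' : {linear F -> M}),
    (forall x, z x = z' (S x)) /\ S u = 0.
Proof.
move=> fM /fM[S [z' [h Su]]]; exists S, z'; split => // x.
by apply/eqP; rewrite -subr_eq0; apply/eqP/h.
Qed.

(** Only the first [N] basis vectors, which carry [u], need to be factored; the others are kept
    unchanged in a second copy of [F]. *)
Lemma eqflat_local (M : lmodType R) :
  (forall (y : nat -> M) N u, trunc N u = u -> flift y u = 0 ->
    exists (S : {linear F -> F}) (z : {linear F -> M}),
      (forall i, (i < N)%N -> y i = z (S (e i))) /\ S u = 0) ->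
  eqflat M.
Proof.
move=> h z u /= zu; have [N uN] := trunc_ex u.
have [|S [z' [hS Su]]] := h (fun i => z (e i)) N u uN.
  by rewrite -zu; apply: freemod_lin_ext => k; rewrite flift_basis.
pose T := flift (fun i => if (i < N)%N then evens (S (e i)) else odds (e i)).
exists T, (copair z' z); split=> [x|].
  apply/eqP; rewrite subr_eq0; apply/eqP.
  apply: (freemod_lin_ext (g := copair z' z \o T)) => k /=.
  by rewrite flift_basis; case: ifP => [/hS ->|_]; rewrite (copair_evens, copair_odds).
have -> : T u = evens (S u).
  apply: (trunc_lin_ext (n := N) (g := evens \o S)) uN => i lin.
  by rewrite flift_basis lin.
by rewrite Su linear0.
Qed.

(** The vectors are killed one after the other, each through the factorization found before. *)
Lemma eqflat_family (M : lmodType R) (z : {linear F -> M}) (x : nat -> F) n :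
  eqflat M -> (forall i, (i < n)%N -> z (x i) = 0) ->
  exists (S : {linear F -> F}) (z' : {linear F -> M}),
    (forall x, z x = z' (S x)) /\ forall i, (i < n)%N -> S (x i) = 0.
Proof.
move=> fM; elim: n => [|n IH] zx; first by exists idfun, z.
have [i lin|S [z' [zE Sx]]] := IH; first exact/zx/leqW.
have [|T [z2 [zE' Tx]]] := @eqflatP _ z' (S (x n)) fM; first by rewrite -zE zx.
exists (T \o S), z2; split=> [y|i]; first by rewrite zE zE'.
by rewrite ltnS leq_eqVlt => /orP[/eqP->//|/Sx /= ->]; rewrite linear0.
Qed.

(** The basis elements in the supports of the first [N] vectors span a free direct summand of finite
    rank [m]; [b] is its inclusion, extended by zero, and [c] the projection onto it, in
    coordinates. *)
Lemma freemod_local_retract K (x : nat -> freemod R K) N :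
  exists m (b : {linear F -> freemod R K}) (c : {linear freemod R K -> F}),
    (forall i, (i < N)%N -> b (c (x i)) = x i) /\
    forall y, trunc m (c y) = c y.
Proof.
have [s us hs] : exists2 s : seq {classic K}, uniq s &
    forall i, (i < N)%N -> forall k : K, x i k != 0 -> (k : {classic K}) \in s.
  elim: N => [|N [s us hs]]; first by exists [::].
  exists (undup (fsupp (x N) ++ s)) => [|i]; first exact: undup_uniq.
  rewrite ltnS leq_eqVlt => /orP[/eqP->|iN] k xk; rewrite mem_undup mem_cat.
    by rewrite mem_fsupp.
  by rewrite (hs i iN) ?orbT.
pose b := flift (fun j => oapp (@fbasis R K) 0 (onth s j)).
pose c := flift (fun k : K => if (k : {classic K}) \in s then e (index (k : {classic K}) s)
  else 0).
exists (size s), b, c; split=> [i iN|y].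
  apply: (freemod_lin_ext_on (f := b \o c) (g := idfun) us _ (hs i iN)) => k ks /=.
  rewrite /c flift_basis ks /b flift_basis onthE.
  rewrite (nth_map k) ?index_mem//=; congr fbasis.
  exact: (@nth_index {classic K} k k s ks).
elim/freemod_ind: y => [|a k y IH]; first by rewrite !linear0.
rewrite !linearPD IH /c flift_basis; case: ifP => ks; last by rewrite linear0.
by rewrite trunc_basis // index_mem.
Qed.

Lemma eqflat_freemod K : eqflat (freemod R K).
Proof.
apply: eqflat_local => y N u uN yu.
have [m [b [c [bc _]]]] := freemod_local_retract y N.
exists (c \o flift y), b; split=> [i iN|]; last by rewrite /= yu linear0.
by rewrite /= flift_basis bc.
Qed.

Lemma pair_inl_is_linear (M N : lmodType R) : linear (fun x : M => (x, 0) : (M * N)%type).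
Proof. by move=> a x y; apply/pair_equal_spec; rewrite /= scaler0 addr0. Qed.
Definition pair_inl (M N : lmodType R) := mklin (@pair_inl_is_linear M N).

Lemma pair_inr_is_linear (M N : lmodType R) : linear (fun y : N => (0, y) : (M * N)%type).
Proof. by move=> a x y; apply/pair_equal_spec; rewrite /= scaler0 addr0. Qed.
Definition pair_inr (M N : lmodType R) := mklin (@pair_inr_is_linear M N).

Lemma eqflat_prod (M N : lmodType R) : eqflat M -> eqflat N -> eqflat (M * N)%type.
Proof.
move=> fM fN z u zu.
have [|S [a [aE Su]]] := @eqflatP _ (fst \o z) u fM; first by rewrite /= zu.
have [|T [b [bE Tu]]] := @eqflatP _ (snd \o z) u fN; first by rewrite /= zu.
pose P : {linear F -> F} := (evens \o S) \+ (odds \o T).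
pose w := copair (pair_inl M N \o a) (pair_inr M N \o b).
exists P, w; split=> [x|] /=; last by rewrite Su Tu !linear0 addr0.
rewrite linearD copair_evens copair_odds /= -aE -bE /=.
by apply/eqP; rewrite subr_eq0; apply/eqP; case: (z x) => p q; apply/pair_equal_spec;
  rewrite /= addr0 add0r.
Qed.

End CountableFree.

Arguments trunc {R} n.
Arguments evens {R}.
Arguments odds {R}.

(** * Subquotients *)

Definition is_submod (R : pzRingType) (V : lmodType R) (U : set V) :=
  U 0 /\ forall a x y, U x -> U y -> U (a *: x + y).

Section Subquotient.
Variables (R : pzRingType) (V : lmodType R) (U W : set V).
Hypotheses (HU : is_submod U) (HW : is_submod W).

Lemma submodD x y : U x -> U y -> U (x + y).
Proof. by move=> ux uy; rewrite -[x]scale1r; apply: HU.2. Qed.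
Lemma submodZ a x : U x -> U (a *: x).
Proof. by move=> ux; rewrite -[_ *: x]addr0; apply: HU.2 => //; apply: HU.1. Qed.
Lemma submodN x : U x -> U (- x).
Proof. by rewrite -scaleN1r; apply: submodZ. Qed.
Lemma submodB x y : U x -> U y -> U (x - y).
Proof. by move=> ux uy; apply: submodD => //; apply: submodN. Qed.

End Subquotient.

Section SubquotientType.
Variables (R : pzRingType) (V : lmodType R) (U W : set V).
Hypotheses (HU : is_submod U) (HW : is_submod W).

(** The coset of [x] modulo [W] within [U]. Since [choose] picks the same element from any starting
    point of a given coset, equivalent elements share one representative, and the quotient has
    Leibniz equality. *)
Definition coset_pred (x : V) : pred V := fun y => `[< U y /\ W (y - x) >].
Definition coset_repr (x : V) : V := choose (coset_pred x) x.

Lemma coset_reprP x : U x -> U (coset_repr x) /\ W (coset_repr x - x).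
Proof.
move=> ux; have : coset_pred x x by apply/asboolP; rewrite subrr; split => //; exact: HW.1.
by move=> /chooseP/asboolP.
Qed.

Lemma eq_coset_repr x y : U x -> U y -> W (x - y) -> coset_repr x = coset_repr y.
Proof.
move=> ux uy xy; rewrite /coset_repr.
have pxy : coset_pred x =1 coset_pred y.
  move=> z; apply/asboolP/asboolP => -[uz zx]; split => //.
    by rewrite -(subrK x z) -addrA; apply: (submodD HW).
  by rewrite -(subrK y z) -addrA; apply: (submodD HW) => //; rewrite -opprB; apply: (submodN HW).
rewrite (eq_choose pxy); apply: choose_id; apply/asboolP => //.
by rewrite subrr; split => //; exact: HW.1.
Qed.

Definition coset_normal (x : V) : bool := `[< U x >] && (coset_repr x == x).

Record normal_repr : Type := NormalRepr { nrepr :> V; nreprP : coset_normal nrepr }.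
HB.instance Definition _ := [isSub for nrepr].
HB.instance Definition _ := [Choice of normal_repr by <:].

(* The closure properties are parameters of the type, so that the module
   structure can be inferred from it. *)
Definition subquo (_ : is_submod U) (_ : is_submod W) : Type := normal_repr.
Local Notation Q := (subquo HU HW).
HB.instance Definition _ := Choice.on Q.
Definition subquo_val (q : Q) : V := nrepr q.

Lemma coset_normal_repr x : U x -> coset_normal (coset_repr x).
Proof.
move=> ux; have [ur wr] := coset_reprP ux; apply/andP; split; first exact/asboolP.
by apply/eqP/eq_coset_repr.
Qed.

(** Made total by sending the elements outside [U] to the class of 0. *)
Definition subquo_mk (x : V) : Q :=
  match pselect (U x) with
  | left ux => NormalRepr (coset_normal_repr ux)
  | right _ => NormalRepr (coset_normal_repr HU.1)
  end.

Lemma subquo_val_in q : U (subquo_val q).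
Proof. by case: q => v /= /andP[/asboolP]. Qed.

Lemma val_subquo_mk x : U x -> W (subquo_val (subquo_mk x) - x).
Proof. by move=> ux; rewrite /subquo_mk; case: pselect => //= ux'; exact: (coset_reprP _).2. Qed.

Lemma subquo_mk_eq x y : U x -> U y -> W (x - y) -> subquo_mk x = subquo_mk y.
Proof.
move=> ux uy xy; apply: val_inj; rewrite /= /subquo_mk.
by case: pselect => //= ?; case: pselect => //= ?; apply: eq_coset_repr.
Qed.

Lemma subquo_valK q : subquo_mk (subquo_val q) = q.
Proof.
apply: val_inj; rewrite /= /subquo_mk; case: pselect => [ux|/(_ (subquo_val_in q))//] /=.
by case: q ux => v /= /andP[_ /eqP].
Qed.

Let add (p q : Q) := subquo_mk (subquo_val p + subquo_val q).
Let opp (p : Q) := subquo_mk (- subquo_val p).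
Let scale (a : R) (p : Q) := subquo_mk (a *: subquo_val p).

Let mkD x y : U x -> U y -> add (subquo_mk x) (subquo_mk y) = subquo_mk (x + y).
Proof.
move=> ux uy; apply: subquo_mk_eq; try by apply: (submodD HU); rewrite //; exact: subquo_val_in.
by rewrite opprD addrACA; apply: (submodD HW); apply: val_subquo_mk.
Qed.
Let mkN x : U x -> opp (subquo_mk x) = subquo_mk (- x).
Proof.
move=> ux; apply: subquo_mk_eq; try by apply: (submodN HU); rewrite //; exact: subquo_val_in.
by rewrite -opprD; apply: (submodN HW); apply: val_subquo_mk.
Qed.
Let mkZ a x : U x -> scale a (subquo_mk x) = subquo_mk (a *: x).
Proof.
move=> ux; apply: subquo_mk_eq; try by apply: (submodZ HU); rewrite //; exact: subquo_val_in.
by rewrite -scalerBr; apply: (submodZ HW); apply: val_subquo_mk.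
Qed.
Let mk_ind (P : Q -> Prop) : (forall x, U x -> P (subquo_mk x)) -> forall p, P p.
Proof. by move=> h p; rewrite -(subquo_valK p); apply/h/subquo_val_in. Qed.

Let HD x y : U x -> U y -> U (x + y). Proof. exact: (submodD HU). Qed.
Let HZ a x : U x -> U (a *: x). Proof. exact: (submodZ HU). Qed.
Let HN x : U x -> U (- x). Proof. exact: (submodN HU). Qed.

Fact subquo_addA : associative add.
Proof. by elim/mk_ind=> x ux; elim/mk_ind=> y uy; elim/mk_ind=> z uz; rewrite !mkD ?addrA//;
  exact: HD. Qed.
Fact subquo_addC : commutative add.
Proof. by move=> p q; rewrite /add addrC. Qed.
Fact subquo_add0 : left_id (subquo_mk 0) add.
Proof. by elim/mk_ind=> x ux; rewrite mkD ?add0r//; exact: HU.1. Qed.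
Fact subquo_addN : left_inverse (subquo_mk 0) opp add.
Proof. by elim/mk_ind=> x ux; rewrite mkN// mkD ?addNr//; exact: HN. Qed.
HB.instance Definition _ := GRing.isZmodule.Build Q
  subquo_addA subquo_addC subquo_add0 subquo_addN.

Fact subquo_scaleA a b p : scale a (scale b p) = scale (a * b) p.
Proof. by elim/mk_ind: p => x ux; rewrite !mkZ ?scalerA//; exact: HZ. Qed.
Fact subquo_scale1 : left_id 1 scale.
Proof. by elim/mk_ind=> x ux; rewrite mkZ ?scale1r. Qed.
Fact subquo_scaleDr : right_distributive scale (@GRing.add Q).
Proof.
move=> a; elim/mk_ind=> x ux; elim/mk_ind=> y uy.
rewrite -[(subquo_mk x + subquo_mk y)%R]/(add _ _) mkD// !mkZ//; last exact: HD.
by rewrite -[RHS]/(add _ _) mkD ?scalerDr//; exact: HZ.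
Qed.
Fact subquo_scaleDl p : {morph scale^~ p : a b / a + b}.
Proof. by elim/mk_ind: p => x ux a b; rewrite -[RHS]/(add (scale _ _) (scale _ _)) !mkZ// mkD
  ?scalerDl//; exact: HZ. Qed.
HB.instance Definition _ := GRing.Zmodule_isLmodule.Build R Q
  subquo_scaleA subquo_scale1 subquo_scaleDr subquo_scaleDl.

Lemma subquo_mkPD a x y : U x -> U y ->
  subquo_mk (a *: x + y) = a *: subquo_mk x + subquo_mk y.
Proof. move=> ux uy; rewrite -[RHS]/(add (scale _ _) _). rewrite mkZ//. rewrite mkD//;
  exact: HZ. Qed.

Lemma subquo_mk_sum I (r : seq I) (a : I -> R) (x : I -> V) : (forall i, U (x i)) ->
  U (\sum_(i <- r) a i *: x i) /\
  subquo_mk (\sum_(i <- r) a i *: x i) = \sum_(i <- r) a i *: subquo_mk (x i).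
Proof.
move=> ux; elim: r => [|i r [IHU IH]]; first by rewrite !big_nil; split=> //; exact: HU.1.
by rewrite !big_cons; split; [exact: HU.2|rewrite subquo_mkPD// IH].
Qed.

Lemma subquo_mk_eq0 x : U x -> subquo_mk x = 0 <-> W x.
Proof.
move=> ux; have U0 := HU.1; split=> [x0|wx]; last by apply: subquo_mk_eq; rewrite ?subr0.
have := val_subquo_mk ux; rewrite x0 => w0.
rewrite -[x](subKr (subquo_val 0)); apply: (submodB HW) => //.
by rewrite -[subquo_val 0]subr0; apply: val_subquo_mk.
Qed.

End SubquotientType.

(** * Flatness and the equational criterion *)

Section Flatness.
Variable R : pzRingType.
Local Notation F := (freemod R nat).
Local Notation e := (@fbasis R nat).

Definition tensor_mapr (A : lmodType R^c) (M N : lmodType R) (z : {linear M -> N})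
  (s : seq (A * M)) : seq (A * N) := [seq (p.1, z p.2) | p <- s].

Lemma tensor_mapr_comp (A : lmodType R^c) (M N P : lmodType R)
    (z : {linear M -> N}) (w : {linear N -> P}) (s : seq (A * M)) :
  tensor_mapr w (tensor_mapr z s) = tensor_mapr (w \o z) s.
Proof. by rewrite /tensor_mapr -map_comp. Qed.

Lemma tensor_mapr_cat (A : lmodType R^c) (M N : lmodType R)
    (z : {linear M -> N}) (s t : seq (A * M)) :
  tensor_mapr z (s ++ t) = tensor_mapr z s ++ tensor_mapr z t.
Proof. exact: map_cat. Qed.

Lemma eq_tensor_mapr (A : lmodType R^c) (M N : lmodType R)
    (z w : {linear M -> N}) (s : seq (A * M)) : z =1 w ->
  tensor_mapr z s = tensor_mapr w s.
Proof. by move=> zw; apply: eq_map => p; rewrite zw. Qed.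

Lemma tensor_eq_mapr (A : lmodType R^c) (M N : lmodType R) (z : {linear M -> N})
    (s t : seq (A * M)) :
  tensor_eq s t -> tensor_eq (tensor_mapr z s) (tensor_mapr z t).
Proof.
elim=> {s t} [s|s t _ IH|s t u _ IH1 _ IH2|s s' t t' _ IH1 _ IH2|s t|m|a b m|a m n|a r m] /=.
- exact: tensor_refl.
- exact: tensor_sym.
- exact: tensor_trans IH1 IH2.
- by rewrite !tensor_mapr_cat; apply: tensor_cat.
- by rewrite !tensor_mapr_cat; apply: tensor_catC.
- exact: tensor_0l.
- exact: tensor_Dl.
- rewrite linearD; exact: tensor_Dr.
- rewrite linearZ_LR; exact: tensor_balanced.
Qed.

Lemma tensor_0r (A : lmodType R^c) (M : lmodType R) (a : A) :
  tensor_eq [:: (a, 0 : M)] [::].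
Proof.
rewrite -[0 : M](scale0r (0 : M)); apply: (tensor_trans _ (tensor_0l A (0 : M))).
by rewrite -[0 : A](scale0r a); apply/tensor_sym/tensor_balanced.
Qed.

Lemma tensor_sumr (A : lmodType R^c) (M : lmodType R) I (r : seq I) (y : I -> M) (a : A) :
  tensor_eq [seq (a, y i) | i <- r] [:: (a, \sum_(i <- r) y i)].
Proof.
elim: r => [|i r IH]; first by rewrite big_nil; apply/tensor_sym/tensor_0r.
rewrite big_cons; apply: (tensor_trans _ (tensor_sym (tensor_Dr _ _ _))).
exact: (tensor_cat (tensor_refl [:: _])).
Qed.

Section FlatEqflat.
Variables (M : lmodType R) (N : nat) (u : F).
Hypothesis uN : trunc N u = u.

(* The y such that the sum of the u i (x) y i vanishes in A (x) M, for A the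
   right ideal generated by the u i. *)
Definition factors (y : nat -> M) :=
  exists (S : {linear F -> F}) (z : {linear F -> M}),
    (forall i, (i < N)%N -> y i = z (S (e i))) /\ S u = 0.

Lemma factorsD x y : factors x -> factors y -> factors (x + y).
Proof.
move=> [S [a [aE Su]]] [T [b [bE Tu]]].
exists ((evens \o S) \+ (odds \o T)), (copair a b); split=> [i iN|] /=.
  by rewrite linearD copair_evens copair_odds -aE// -bE.
by rewrite Su Tu !linear0 addr0.
Qed.

Lemma factorsN y : factors y -> factors (- y).
Proof.
move=> [S [z [zE Su]]]; exists S, (\- z); split=> // i iN /=.
by rewrite -zE.
Qed.

Lemma factors_pure (c : nat -> R) (m : M) :
  \sum_(i < N) (u i : R) * c i = 0 -> factors (fun i => c i *: m).
Proof.
move=> uc; exists (flift (fun i => c i *: e 0%N)), (flift (fun=> m)).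
split=> [i iN|]; first by rewrite flift_basis linearZ_LR flift_basis.
rewrite -uN trunc_sum linear_sum; under eq_bigr => i _ do
  rewrite linearZ_LR flift_basis scalerA.
by rewrite -scaler_suml uc scale0r.
Qed.

Lemma factors0 : factors 0.
Proof.
have [|S [z [zE Su]]] := @factors_pure (fun=> 0) 0.
  by rewrite big1// => i _; rewrite mulr0.
by exists S, z; split=> // i iN; rewrite -zE// scale0r.
Qed.

Lemma factors_sum I (r : seq I) (y : I -> nat -> M) :
  (forall i, factors (y i)) -> factors (\sum_(i <- r) y i).
Proof.
move=> h; elim: r => [|i r IH]; first by rewrite big_nil; exact: factors0.
by rewrite big_cons; apply: factorsD.
Qed.

(** [R^c^o] is [R] as a right module over itself. *)
Definition right_ideal (a : R^c^o) := exists c : nat -> R, a = \sum_(i < N) (u i : R) * c i :> R.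

Lemma right_ideal_submod : is_submod right_ideal.
Proof.
split=> [|r x y [c xE] [d yE]].
  by exists (fun=> 0); rewrite big1// => i _; rewrite mulr0.
exists (fun i => c i * r + d i).
under eq_bigr do rewrite mulrDr mulrA.
by rewrite big_split -mulr_suml /= -xE -yE.
Qed.

Lemma zero_submod (V : lmodType R^c) : is_submod [set 0 : V].
Proof. by split=> // a x y -> ->; rewrite scaler0 addr0. Qed.

Local Notation A := (subquo right_ideal_submod (zero_submod R^c^o)).

Lemma ideal_val_linear : linear (@subquo_val _ _ _ _ _ _ : A -> R^c^o).
Proof.
have mkK x : right_ideal x -> subquo_val (subquo_mk right_ideal_submod (zero_submod R^c^o) x) = x.
  by move=> ux; apply: subr0_eq; exact: (val_subquo_mk right_ideal_submod (zero_submod _) ux).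
move=> a x y; rewrite -{1}(subquo_valK x) -{1}(subquo_valK y).
have ux := subquo_val_in x; have uy := subquo_val_in y.
by rewrite -subquo_mkPD// mkK//; apply: right_ideal_submod.2.
Qed.

(** Choosing coefficients [c a] of each [a] in the right ideal [A] gives a well-defined map from the
    tensor product of [A] and [M] to families modulo [factors]. It sends the sum of the [u j] (x)
    [y j] to the class of [y], and by flatness this tensor is zero. *)
Lemma flat_factors (y : nat -> M) : flat M -> flift y u = 0 -> factors y.
Proof.
move=> fM yu; pose f : {linear A -> R^c^o} := mklin ideal_val_linear.
have finj : injective f by move=> a b ab; apply: val_inj.
have [c cE] := choice (fun a : A => subquo_val_in a : right_ideal (f a)).
pose phi (s : seq (A * M)) : nat -> M := \sum_(p <- s) (fun i => c p.1 i *: p.2).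
have phi0 : phi [::] = 0 by rewrite /phi big_nil.
have phi1 a m : phi [:: (a, m)] = (fun i => c a i *: m) by rewrite /phi big_seq1.
have phi_cat s t : phi (s ++ t) = phi s + phi t by rewrite /phi big_cat.
have phi2 a b m n : phi [:: (a, m); (b, n)] = (fun i => c a i *: m) + (fun i => c b i *: n).
  by rewrite -cat1s phi_cat !phi1.
have phi_eq s t : tensor_eq s t -> factors (phi s - phi t).
  elim=> {s t} [s|s t _ IH|s t v _ IH1 _ IH2|s s' t t' _ IH1 _ IH2|s t|m|a b m|a m n|a r m] /=.
  - by rewrite subrr; exact: factors0.
  - by rewrite -opprB; exact: factorsN.
  - by rewrite -(subrK (phi t) (phi s)) -addrA; exact: factorsD.
  - by rewrite !phi_cat opprD addrACA; exact: factorsD.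
  - by rewrite !phi_cat [phi t + _]addrC subrr; exact: factors0.
  - rewrite phi1 phi0 subr0; apply: factors_pure.
    by rewrite -cE linear0.
  - rewrite phi1 phi2.
    rewrite (_ : _ - _ = (fun i => (c (a + b) i - (c a i + c b i)) *: m)).
      apply: factors_pure; under eq_bigr do rewrite mulrBr mulrDr.
      by rewrite sumrB big_split /= -!cE linearD subrr.
    by apply/funext => i; rewrite scalerBl scalerDl.
  - rewrite phi1 phi2 (_ : _ - _ = 0); first exact: factors0.
    by apply/funext => i; rewrite /= !fctE scalerDr subrr.
  - rewrite !phi1 (_ : _ - _ = (fun i => (c ((r : R^c) *: a) i - c a i * r) *: m)).
      apply: factors_pure; under eq_bigr do rewrite mulrBr mulrA.
      by rewrite sumrB -mulr_suml -!cE linearZ_LR subrr.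
    by apply/funext => i; rewrite scalerBl -scalerA.
pose mk := subquo_mk right_ideal_submod (zero_submod R^c^o).
pose d j i : R := (i == j :> nat)%:R.
have dE (j : 'I_N) : \sum_(i < N) (u i : R) * d j i = u j.
  rewrite (bigD1 j)//= /d eqxx mulr1 big1 ?addr0// => i ij.
  by rewrite (negbTE (_ : (i : nat) != j)) ?mulr0.
have fmk (j : 'I_N) : f (mk (u j)) = u j.
  by apply: subr0_eq; apply: (val_subquo_mk right_ideal_submod (zero_submod _)); exists (d j).
pose s : seq (A * M) := [seq (mk (u j), y j) | j : 'I_N <- index_enum 'I_N].
(* After the inclusion of [A] in [R], the scalars [u j] move to the right and the tensor becomes 1
   (x) [flift y u], which is zero. *)
have s0 : tensor_eq s [::].
  apply: (fM A R^c^o f finj); rewrite /tensor_map -map_comp.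
  have -> : [seq ((fun p : A * M => (f p.1, p.2)) \o (fun j : 'I_N => (mk (u j), y j))) i | i
    <- index_enum 'I_N]
      = [seq ((u j : R^c^o), y j) | j : 'I_N <- index_enum 'I_N].
    by apply: eq_map => j /=; congr pair; exact: fmk.
  apply: (@tensor_trans _ _ _ _ [seq ((1 : R^c^o), (u j : R) *: y j) | j : 'I_N <- index_enum
    'I_N]).
    elim: (index_enum _) => [|j r IH] /=; first exact: tensor_refl.
    apply: (tensor_cat (s := [:: _]) (s' := [:: _])) IH.
    by rewrite -[X in (X, _)](mulr1 (u j : R^c)); apply: tensor_balanced.
  apply: (tensor_trans (tensor_sumr _ _ _)).
  have -> : \sum_(j < N) (u j : R) *: y j = 0.
    by rewrite -[RHS]yu -[in RHS]uN trunc_sum linear_sum; apply: eq_bigr => j _;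
      rewrite linearZ_LR flift_basis.
  exact: tensor_0r.
have := phi_eq _ _ s0; rewrite phi0 subr0 => ps.
(* Both [d j] and [c (mk (u j))] are coefficients of [u j], so their difference is a relation among
   the [u i]; hence [y] and [phi s] agree modulo [factors]. *)
have : factors (\sum_(j < N) (fun i => (d j i - c (mk (u j)) i) *: y j) + phi s).
  apply: factorsD => //; apply: factors_sum => j; apply: factors_pure.
  by under eq_bigr do rewrite mulrBr; rewrite sumrB dE -cE fmk subrr.
rewrite /phi big_map -big_split /= => -[S [z [zE Su]]]; exists S, z; split=> // i iN.
rewrite -zE// fct_sumE (bigD1 (Ordinal iN))//= big1 => [|j ji]; rewrite !fctE scalerBl subrK.
  by rewrite /d eqxx scale1r addr0.
by rewrite /d eq_sym (negbTE (_ : (j : nat) != i)) ?scale0r.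
Qed.

End FlatEqflat.

Lemma flat_eqflat (M : lmodType R) : flat M -> eqflat M.
Proof.
by move=> fM; apply: eqflat_local => y N u uN yu; apply: flat_factors.
Qed.

End Flatness.

(** * From the equational criterion to flatness *)

Section EqflatFlat.
Variable R : pzRingType.
Local Notation F := (freemod R nat).
Local Notation e := (@fbasis R nat).

Section Lifting.
Variables (B : lmodType R^c) (M : lmodType R).

Lemma tensor_lift_ex (s : seq (B * M)) :
  exists (z : {linear F -> M}) (s' : seq (B * F)), s = tensor_mapr z s'.
Proof.
exists (flift (fun i => (nth (0, 0) s i).2)), (mkseq (fun i => ((nth (0, 0) s i).1, e i)) (size
  s)).
rewrite /tensor_mapr /mkseq -map_comp -[LHS](mkseq_nth (0, 0)); apply: eq_map => i /=.
by rewrite flift_basis -surjective_pairing.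
Qed.

(** Two lifts of the same formal sum differ by finitely many vectors killed by [z], which the
    equational criterion annihilates at once. *)
Lemma tensor_unify (z : {linear F -> M}) (s t : seq (B * F)) : eqflat M ->
  tensor_mapr z s = tensor_mapr z t ->
  exists (S : {linear F -> F}) (z' : {linear F -> M}),
    z =1 z' \o S /\ tensor_mapr S s = tensor_mapr S t.
Proof.
move=> fM st; have sz : size s = size t by have := congr1 size st; rewrite !size_map.
have nthst i : (i < size s)%N ->
    (nth (0, 0) s i).1 = (nth (0, 0) t i).1 /\ z (nth (0, 0) s i).2 = z (nth (0, 0) t i).2.
  move=> lis; have := congr1 (fun r => nth (0, 0) r i) st.
  by rewrite !(nth_map (0, 0)) -?sz// => -[].
have [i /nthst[_ zi]|S [z' [zE Sx]]] :=
    @eqflat_family _ _ z (fun i => (nth (0, 0) s i).2 - (nth (0, 0) t i).2) (size s) fM.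
  by rewrite linearB zi subrr.
exists S, z'; split=> //; apply: (eq_from_nth (x0 := (0, 0))); rewrite ?size_map// => i lis.
rewrite !(nth_map (0, 0)) -?sz//; have [-> _] := nthst i lis; congr pair.
by apply: subr0_eq; rewrite -linearB Sx.
Qed.

(** A derivation of an equality of tensors involves finitely many elements of [M] and can be carried
    out over [F]. Only transitivity needs flatness, to identify the two lifts of the middle term. *)
Lemma tensor_eq_lift (s t : seq (B * M)) : eqflat M -> tensor_eq s t ->
  exists (z : {linear F -> M}) (s' t' : seq (B * F)),
    [/\ s = tensor_mapr z s', t = tensor_mapr z t' & tensor_eq s' t'].
Proof.
move=> fM; have evensK (f g : {linear F -> M}) (r : seq (B * F)) :
    tensor_mapr f r = tensor_mapr (copair f g) (tensor_mapr evens r).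
  by rewrite tensor_mapr_comp; apply: eq_tensor_mapr => x; rewrite /= copair_evens.
have oddsK (f g : {linear F -> M}) (r : seq (B * F)) :
    tensor_mapr g r = tensor_mapr (copair f g) (tensor_mapr odds r).
  by rewrite tensor_mapr_comp; apply: eq_tensor_mapr => x; rewrite /= copair_odds.
elim=> {s t} [s|s t _ [z [s' [t' [-> -> st]]]]
  |s t v _ [z1 [s' [t1 [sE tE st]]]] _ [z2 [t2 [v' [tE' vE tv]]]]
  |s s' t t' _ [z1 [s1 [s2 [-> -> ss]]]] _ [z2 [t1 [t2 [-> -> tt]]]]|s t|m|a b m|a m n|a r m] /=.
- by have [z [s' ->]] := tensor_lift_ex s; exists z, s', s'; split=> //; exact: tensor_refl.
- by exists z, t', s'; split=> //; exact: tensor_sym.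
- have [|S [z [zE Seq]]] := @tensor_unify (copair z1 z2) (tensor_mapr evens t1) (tensor_mapr
  odds t2) fM.
    by rewrite -evensK -oddsK -tE.
  exists z, (tensor_mapr S (tensor_mapr evens s')), (tensor_mapr S (tensor_mapr odds v')); split.
  + by rewrite tensor_mapr_comp -(eq_tensor_mapr _ zE) -evensK.
  + by rewrite tensor_mapr_comp -(eq_tensor_mapr _ zE) -oddsK.
  + apply: (@tensor_trans _ _ _ _ (tensor_mapr S (tensor_mapr evens t1))); last rewrite Seq;
      by do 2 apply: tensor_eq_mapr.
- exists (copair z1 z2), (tensor_mapr evens s1 ++ tensor_mapr odds t1), (tensor_mapr evens s2
  ++ tensor_mapr odds t2).
  rewrite !tensor_mapr_cat -!evensK -!oddsK; split=> //.
  by apply: tensor_cat; apply: tensor_eq_mapr.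
- have [z1 [s' ->]] := tensor_lift_ex s; have [z2 [t' ->]] := tensor_lift_ex t.
  exists (copair z1 z2), (tensor_mapr evens s' ++ tensor_mapr odds t'), (tensor_mapr odds t' ++
    tensor_mapr evens s').
  by rewrite !tensor_mapr_cat -!evensK -!oddsK; split=> //; exact: tensor_catC.
- exists (flift (fun=> m)), [:: (0, e 0%N)], [::].
  by rewrite /tensor_mapr /= flift_basis; split=> //; exact: tensor_0l.
- exists (flift (fun=> m)), [:: (a + b, e 0%N)], [:: (a, e 0%N); (b, e 0%N)].
  by rewrite /tensor_mapr /= flift_basis; split=> //; exact: tensor_Dl.
- exists (flift (fun i => if i is 0%N then m else n)), [:: (a, e 0%N + e 1%N)], [:: (a, e 0%N);
  (a, e 1%N)].
  by rewrite /tensor_mapr /= linearD !flift_basis; split=> //; exact: tensor_Dr.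
- exists (flift (fun=> m)), [:: ((r : R^c) *: a, e 0%N)], [:: (a, r *: e 0%N)].
  by rewrite /tensor_mapr /= linearZ_LR !flift_basis; split=> //; exact: tensor_balanced.
Qed.

End Lifting.

Section TensorFree.
Variable A : lmodType R^c.

(** The isomorphism of [A] (x) [F] with the direct sum of countably many copies of [A]. *)
Definition tensor_coord (s : seq (A * F)) (i : nat) : A := \sum_(p <- s) (p.2 i : R^c) *: p.1.

Lemma tensor_coord_cat s t i : tensor_coord (s ++ t) i = tensor_coord s i + tensor_coord t i.
Proof. by rewrite /tensor_coord big_cat. Qed.

Lemma tensor_coord1 a x i : tensor_coord [:: (a, x)] i = (x i : R^c) *: a.
Proof. by rewrite /tensor_coord big_seq1. Qed.

Lemma tensor_coord2 a x b y i :
  tensor_coord [:: (a, x); (b, y)] i = (x i : R^c) *: a + (y i : R^c) *: b.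
Proof. by rewrite -[_ :: _](cat1s _ [:: _]) tensor_coord_cat !tensor_coord1. Qed.

Lemma tensor_eq_coord s t : tensor_eq s t -> tensor_coord s =1 tensor_coord t.
Proof.
elim=> {s t} [s|s t _ IH|s t v _ IH1 _ IH2|s s' t t' _ IH1 _ IH2|s t|m|a b m|a m n|a r m] i //=.
- by rewrite IH1.
- by rewrite !tensor_coord_cat IH1 IH2.
- by rewrite !tensor_coord_cat addrC.
- by rewrite tensor_coord1 scaler0 /tensor_coord big_nil.
- by rewrite tensor_coord1 tensor_coord2 scalerDr.
- by rewrite tensor_coord1 tensor_coord2 -scalerDl.
- by rewrite !tensor_coord1 scalerA.
Qed.

Lemma tensor_merge (r : seq nat) (g h : nat -> A) :
  tensor_eq ([seq (g i, e i) | i <- r] ++ [seq (h i, e i) | i <- r])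
            [seq (g i + h i, e i) | i <- r].
Proof.
elim: r => [|i r IH] /=; first exact: tensor_refl.
apply: (@tensor_trans _ _ _ _ ([:: (g i, e i); (h i, e i)] ++
  ([seq (g i, e i) | i <- r] ++ [seq (h i, e i) | i <- r]))).
  apply: (tensor_cat (tensor_refl [:: _])).
  rewrite -[(h i, e i) :: [seq _ | _ <- r]]cat1s catA.
  exact: (tensor_cat (tensor_catC _ [:: _]) (tensor_refl _)).
by apply: (tensor_cat (s' := [:: _])) IH; apply/tensor_sym/tensor_Dl.
Qed.

(** Each pair is split along the basis and the terms with the same [e i] are merged; hence the
    coordinates determine the tensor. *)
Lemma tensor_normal N (s : seq (A * F)) : {in s, forall p, trunc N p.2 = p.2} ->
  tensor_eq s [seq (tensor_coord s i, e i) | i <- iota 0 N].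
Proof.
elim: s => [_|[a x] s IH hs].
  rewrite (eq_map (g := fun i => (0, e i))); last by move=> i; rewrite /tensor_coord big_nil.
  apply: tensor_sym; elim: (iota _ _) => [|i r IH] /=; first exact: tensor_refl.
  exact: (tensor_cat (s := [:: _]) (s' := [::]) (tensor_0l _ _) IH).
have xN : trunc N x = x by apply: (hs (a, x)); rewrite mem_head.
have {}IH := IH (fun p ps => hs p (mem_behead (s := _ :: _) ps)).
rewrite (eq_map (g := fun i => ((x i : R^c) *: a + tensor_coord s i, e i))); last first.
  by move=> i; rewrite -cat1s tensor_coord_cat tensor_coord1.
apply: (tensor_trans _ (tensor_merge _ _ _)); rewrite -cat1s; apply: tensor_cat IH.
apply: (@tensor_trans _ _ _ _ [seq (a, (x i : R) *: e i) | i <- iota 0 N]).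
  apply: tensor_sym; apply: tensor_trans (tensor_sumr _ _ _) _.
  rewrite -{2}xN trunc_sum -(big_mkord xpredT (fun i => (x i : R) *: e i)) /index_iota subn0.
  exact: tensor_refl.
elim: (iota _ _) => [|i r IHr] /=; first exact: tensor_refl.
apply: (tensor_cat (s := [:: _]) (s' := [:: _])) IHr.
exact/tensor_sym/tensor_balanced.
Qed.

End TensorFree.

Lemma flat_countable_free : flat F.
Proof.
move=> A B f finj s t st.
have [N hN] : exists N, {in s ++ t, forall p, trunc N p.2 = p.2}.
  elim: (s ++ t) => [|[a x] r [N IH]]; first by exists 0%N.
  have [m xm] := trunc_ex x; exists (maxn m N) => p; rewrite in_cons => /predU1P[->|/IH] /=.
    exact: trunc_leq (leq_maxl _ _) xm.
  exact: trunc_leq (leq_maxr _ _).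
have coordE (r : seq (A * F)) i : tensor_coord (tensor_map f r) i = f (tensor_coord r i).
  rewrite /tensor_coord big_map linear_sum; apply: eq_bigr => p _ /=.
  by rewrite linearZ_LR.
have eq_coord i : tensor_coord s i = tensor_coord t i.
  by apply: finj; rewrite -!coordE; apply: tensor_eq_coord.
apply: (tensor_trans (@tensor_normal _ N s _)) => [p ps|].
  by apply: hN; rewrite mem_cat ps.
under eq_map => i do rewrite eq_coord.
apply/tensor_sym/tensor_normal => p pt.
by apply: hN; rewrite mem_cat pt orbT.
Qed.

(** An equality over [B] and [M] is lifted to [B] and [F]. The lifts keep their first components, so
    they come from [A], where flatness of [F] applies; the result is then pushed forward to [M]. *)
Lemma eqflat_flat (M : lmodType R) : eqflat M -> flat M.
Proof.
move=> fM A B f finj s t st.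
have [z [p [q [sE tE pq]]]] := tensor_eq_lift fM st.
have lift (r : seq (A * M)) (p' : seq (B * F)) : tensor_map f r = tensor_mapr z p' ->
    exists2 r' : seq (A * F), p' = tensor_map f r' & r = tensor_mapr z r'.
  elim: r p' => [|[a m] r IH] [|[b x] p'] //=; first by exists [::].
  by case=> <- -> /IH[r' -> ->]; exists ((a, x) :: r').
have [s' pE ->] := lift _ _ sE; have [t' qE ->] := lift _ _ tE.
apply: tensor_eq_mapr; apply: (flat_countable_free finj).
by rewrite -pE -qE.
Qed.

End EqflatFlat.

(** * Elimination of quantifiers down to positive primitive formulas *)

Section Formulas.
Variable R : pzRingType.
Local Notation F := (freemod R nat).
Local Notation e := (@fbasis R nat).

Lemma eval_lin (M N : lmodType R) (f : {linear M -> N}) n (v : 'I_n -> M) (t : term R n) :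
  eval (f \o v) t = f (eval v t).
Proof.
elim: t => [i||t IHt u IHu|r t IH] //=; first by rewrite linear0.
  by rewrite IHt IHu linearD.
by rewrite IH linearZ_LR.
Qed.

Lemma evalB (M : lmodType R) n (v w : 'I_n -> M) (t : term R n) :
  eval (fun i => v i - w i) t = eval v t - eval w t.
Proof.
elim: t => [i||t IHt u IHu|r t IH] //=; first by rewrite subrr.
  by rewrite IHt IHu opprD addrACA.
by rewrite IH scalerBr.
Qed.

Lemma eval0 (M : lmodType R) n (t : term R n) : eval (fun=> 0 : M) t = 0.
Proof. by elim: t => [i||t IHt u IHu|r t IH] //=; rewrite ?IHt ?IHu ?IH (addr0, scaler0). Qed.

Lemma extend_comp (M N : Type) (f : M -> N) n (x : M) (v : 'I_n -> M) :
  extend (f x) (f \o v) = f \o extend x v.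
Proof. by apply/funext => i; rewrite /extend /=; case: unlift. Qed.

Lemma extendB (M : lmodType R) n (x y : M) (v w : 'I_n -> M) :
  extend (x - y) (fun i => v i - w i) = (fun i => extend x v i - extend y w i).
Proof. by apply/funext => i; rewrite /extend; case: unlift. Qed.

Lemma extend_cst (M : Type) n (x : M) : extend x (fun _ : 'I_n => x) = (fun=> x).
Proof. by apply/funext => i; rewrite /extend; case: unlift. Qed.

(** Positive primitive formulas without the prenex requirement of [pp], hence closed under
    conjunction. *)
Fixpoint ppos n (phi : formula R n) : bool :=
  match phi with
  | fEq _ _ _ => true
  | fAnd _ p q => ppos p && ppos q
  | fEx _ p => ppos p
  | _ => false
  end.

Lemma eq_conj_ppos n (phi : formula R n) : eq_conj phi -> ppos phi.
Proof. by elim: phi => //= m p IHp q IHq /andP[/IHp -> /IHq ->]. Qed.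

Lemma pp_ppos n (phi : formula R n) : pp phi -> ppos phi.
Proof. by elim: phi => //= m p _ q _ /andP[/eq_conj_ppos -> /eq_conj_ppos ->]. Qed.

Lemma ppos_hom (M N : lmodType R) (f : {linear M -> N}) n (phi : formula R n) v :
  ppos phi -> sat phi v -> sat phi (f \o v).
Proof.
elim: phi v => //= {n} [n t u|n p IHp q IHq|n p IH] v.
- by rewrite !eval_lin => _ ->.
- by move=> /andP[hp hq] [sp sq]; split; [exact: IHp|exact: IHq].
- by move=> hp [x sx]; exists (f x); rewrite extend_comp; exact: IH.
Qed.

Lemma ppos0 (M : lmodType R) n (phi : formula R n) : ppos phi -> sat phi (fun=> 0 : M).
Proof.
elim: phi => //= {n} [n t u|n p IHp q IHq|n p IH].
- by rewrite !eval0.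
- by move=> /andP[/IHp ? /IHq ?].
- by move=> /IH sp; exists 0; rewrite extend_cst.
Qed.

Lemma pposB (M : lmodType R) n (phi : formula R n) (v w : 'I_n -> M) : ppos phi ->
  sat phi v -> sat phi w -> sat phi (fun i => v i - w i).
Proof.
elim: phi v w => //= {n} [n t u|n p IHp q IHq|n p IH] v w.
- by rewrite !evalB => _ -> ->.
- by move=> /andP[hp hq] [sp sq] [sp' sq']; split; [exact: IHp|exact: IHq].
- by move=> hp [x sx] [y sy]; exists (x - y); rewrite extendB; exact: IH.
Qed.

Lemma pposD (M : lmodType R) n (phi : formula R n) (v w : 'I_n -> M) : ppos phi ->
  sat phi v -> sat phi w -> sat phi (fun i => v i + w i).
Proof.
move=> hp sv sw; have := pposB hp sv (pposB hp (ppos0 M hp) sw).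
by congr sat; apply/funext => i; rewrite sub0r opprK.
Qed.

(** With this lemma and the next, the solutions for given parameters form, if any exist, a coset of
    the group of solutions for zero parameters. *)
Lemma ppos_extendD (M : lmodType R) n (phi : formula R n.+1) (x y : M) v : ppos phi ->
  sat phi (extend x v) -> sat phi (extend y (fun=> 0)) -> sat phi (extend (x + y) v).
Proof.
move=> hp sx sy; have := pposD hp sx sy.
by congr sat; apply/funext => i; rewrite /extend; case: unlift => //= j; rewrite addr0.
Qed.

Lemma ppos_extendB (M : lmodType R) n (phi : formula R n.+1) (x y : M) v : ppos phi ->
  sat phi (extend x v) -> sat phi (extend y v) -> sat phi (extend (x - y) (fun=> 0)).
Proof.
move=> hp sx sy; have := pposB hp sx sy; rewrite -extendB.
by congr (sat _ (extend _ _)); apply/funext => i; rewrite subrr.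
Qed.

(** The equational criterion is applied to each equation in turn; what was already satisfied in [F]
    is preserved by the later maps. *)
Lemma ppos_lift (M : lmodType R) n (phi : formula R n) (z : {linear F -> M}) v :
  eqflat M -> ppos phi -> sat phi (z \o v) ->
  exists (S : {linear F -> F}) (z' : {linear F -> M}), z =1 z' \o S /\ sat phi (S \o v).
Proof.
move=> fM; elim: phi z v => //= {n} [n t u|n p IHp q IHq|n p IH] z v.
- rewrite !eval_lin => _ /eqP; rewrite -subr_eq0 -linearB => /eqP/(eqflatP fM)[S [z' [zE St]]].
  by exists S, z'; split=> //; rewrite !eval_lin; apply: subr0_eq; rewrite -linearB.
- move=> /andP[hp hq] [/(IHp _ _ hp)[S [z' [zE sp]]] sq].
  have [|T [z2 [zE' sq']]] := IHq z' (S \o v) hq.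
    by move: sq; congr sat; apply/funext => i; rewrite /= zE.
  exists (T \o S), z2; split=> [x|]; first by rewrite zE /= zE'.
  by split=> //; exact: (ppos_hom T hp sp).
(* The witness [x] is adjoined as the image of a basis vector in a second copy of [F]. *)
- move=> hp [x sx]; pose z1 := copair z (flift (fun=> x)).
  have [|S [z' [zE sp]]] := IH z1 (extend (odds (e 0%N)) (evens \o v)) hp.
    move: sx; congr sat; rewrite -extend_comp /= copair_odds flift_basis.
    by congr extend; apply/funext => i; rewrite /= copair_evens.
  exists (S \o evens), z'; split=> [y|]; first by rewrite -[RHS]zE copair_evens.
  by exists (S (odds (e 0%N))); rewrite -extend_comp in sp.
Qed.

(** [M] is the direct sum of a copy of [F] and a complement, the kernel of [b], that contains the
    given tuple. *)
Definition roomy (M : lmodType R) := forall n (v : 'I_n -> M),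
  exists (a : {linear F -> M}) (b : {linear M -> F}), cancel a b /\ forall i, b (v i) = 0.

Definition free_entails n (phi psi : formula R n.+1) :=
  forall x : F, sat phi (extend x (fun=> 0)) -> sat psi (extend x (fun=> 0)).

(** By [ppos_lift], a solution of [phi] in [M] is the image of a solution in [F], where the
    entailment holds. *)
Lemma eqflat_entails (M : lmodType R) n (phi psi : formula R n.+1) (x : M) :
  eqflat M -> ppos phi -> ppos psi -> free_entails phi psi ->
  sat phi (extend x (fun=> 0)) -> sat psi (extend x (fun=> 0)).
Proof.
move=> fM hp hq pq sx.
have E (N : lmodType R) (f : {linear F -> N}) y : extend (f y) (fun _ : 'I_n => 0) = f \o
  extend y (fun=> 0).
  by rewrite -extend_comp; congr extend; apply/funext => i /=; rewrite linear0.
pose z : {linear F -> M} := flift (fun=> x); have zx : z (e 0%N) = x by rewrite flift_basis.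
have [|S [z' [zE sp]]] := @ppos_lift M n.+1 phi z (extend (e 0%N) (fun=> 0)) fM hp.
  by rewrite -E zx.
by rewrite -zx zE [(_ \o _) _]/= E; apply: ppos_hom => //; apply: pq; rewrite E.
Qed.

Definition clause n := (formula R n * seq (formula R n))%type.

Definition sat_none (M : lmodType R) n (l : seq (formula R n)) (v : 'I_n -> M) : Prop :=
  foldr (fun psi P => ~ sat psi v /\ P) True l.
Definition sat_clause (M : lmodType R) n (c : clause n) (v : 'I_n -> M) : Prop :=
  sat c.1 v /\ sat_none c.2 v.
Definition sat_dnf (M : lmodType R) n (D : seq (clause n)) (v : 'I_n -> M) : Prop :=
  foldr (fun c P => sat_clause c v \/ P) False D.
Definition ppos_clause n (c : clause n) := ppos c.1 && all (@ppos n) c.2.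

Lemma sat_none_cat (M : lmodType R) n l l' (v : 'I_n -> M) :
  sat_none (l ++ l') v <-> sat_none l v /\ sat_none l' v.
Proof. by elim: l => [|p l IH] /=; tauto. Qed.

Lemma sat_dnf_cat (M : lmodType R) n D D' (v : 'I_n -> M) :
  sat_dnf (D ++ D') v <-> sat_dnf D v \/ sat_dnf D' v.
Proof. by elim: D => [|p l IH] /=; tauto. Qed.

Definition fTrue n : formula R n := fEq (tZero R n) (tZero R n).

Definition dnf_and n (D D' : seq (clause n)) : seq (clause n) :=
  flatten [seq [seq (fAnd c.1 d.1, c.2 ++ d.2) | d <- D'] | c <- D].
Definition clause_not n (c : clause n) : seq (clause n) :=
  (fTrue n, [:: c.1]) :: [seq (psi, [::]) | psi <- c.2].
Definition dnf_not n (D : seq (clause n)) : seq (clause n) :=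
  foldr (fun c => dnf_and (clause_not c)) [:: (fTrue n, [::])] D.
(* If phi entails psi on F, then the solution sets of phi and of phi /\ psi with
   given parameters are cosets of the same group, so that the second one is empty
   or equal to the first; otherwise psi is avoided by a translation inside a free
   direct summand that is disjoint from the parameters. *)
Definition clause_ex n (c : clause n.+1) : clause n :=
  (fEx c.1, [seq fEx (fAnd c.1 psi) | psi <- c.2 & `[< free_entails c.1 psi >]]).

Lemma sat_dnf_and (M : lmodType R) n D D' (v : 'I_n -> M) :
  sat_dnf (dnf_and D D') v <-> sat_dnf D v /\ sat_dnf D' v.
Proof.
elim: D => [|c D IH] /=; first by tauto.
rewrite /dnf_and /= sat_dnf_cat -/(dnf_and D D') IH.
suff -> : sat_dnf [seq (fAnd c.1 d.1, c.2 ++ d.2) | d <- D'] v <->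
    sat_clause c v /\ sat_dnf D' v by tauto.
elim: D' {IH} => [|d D' IH'] /=; first by tauto.
by rewrite IH' /sat_clause /= sat_none_cat; tauto.
Qed.

Lemma sat_clause_not (M : lmodType R) n (c : clause n) (v : 'I_n -> M) :
  sat_dnf (clause_not c) v <-> ~ sat_clause c v.
Proof.
case: c => p l; rewrite /clause_not /sat_clause /= /sat_clause /=.
suff -> : sat_dnf [seq (psi, [::]) | psi <- l] v <-> ~ sat_none l v.
  by have := EM (sat p v); tauto.
elim: l => [|q l IH] /=; first by tauto.
by rewrite IH /sat_clause /=; have := EM (sat q v); tauto.
Qed.

Lemma sat_dnf_not (M : lmodType R) n D (v : 'I_n -> M) :
  sat_dnf (dnf_not D) v <-> ~ sat_dnf D v.
Proof.
elim: D => [|c D IH] /=; first by rewrite /sat_clause /=; tauto.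
by rewrite sat_dnf_and sat_clause_not IH; tauto.
Qed.

Lemma ppos_dnf_and n (D D' : seq (clause n)) :
  all (@ppos_clause n) D -> all (@ppos_clause n) D' -> all (@ppos_clause n) (dnf_and D D').
Proof.
move=> hD hD'; elim: D hD => [//|c D IH] /= /andP[/andP[c1 c2] hD].
rewrite /dnf_and /= all_cat -/(dnf_and D D') IH// andbT all_map;
  apply: sub_all hD' => d /andP[d1 d2].
by rewrite /ppos_clause /= c1 d1 all_cat c2 d2.
Qed.

Lemma ppos_dnf_not n (D : seq (clause n)) :
  all (@ppos_clause n) D -> all (@ppos_clause n) (dnf_not D).
Proof.
elim: D => [//|c D IH] /= /andP[/andP[c1 c2] /IH]; apply: ppos_dnf_and.
by rewrite /= /ppos_clause /= c1 all_map /=; apply: sub_all c2 => p /= ->.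
Qed.

Lemma sat_clause_ex (M : lmodType R) n (c : clause n.+1) (v : 'I_n -> M) :
  eqflat M -> roomy M -> ppos_clause c ->
  sat_clause (clause_ex c) v <-> exists x, sat_clause c (extend x v).
Proof.
move=> fM rM; case: c => p l; rewrite /ppos_clause /sat_clause /= => /andP[hp hl]; split.
  move=> [[x0 sx0]]; elim: l hl => [_ _|q l IH] /=; first by exists x0.
  move=> /andP[hq hl]; case: asboolP => [pq [npq /(IH hl)[x [sx nx]]]|npq /(IH hl)[x [sx nx]]].
    by exists x; do 2 split=> //; move=> sq; apply: npq; exists x.
  have /existsNP[h /not_implyP[hph nqh]] := npq.
  (* The copy of [F] given by [a] avoids [x] and [v]. Adding [a h] to [x] preserves [p], while [q]
     fails at the sum because its image under [b] is [h]. *)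
  have [a [b [ab bv]]] := rM n.+1 (extend x v).
  have bx : b x = 0 by have := bv ord0; rewrite /extend unlift_none.
  have bv' i : b (v i) = 0 by have := bv (lift ord0 i); rewrite /extend liftK.
  have E (N : lmodType R) (f : {linear M -> N}) y w : (forall i, f (v i) = w i) ->
      f \o extend y v = extend (f y) w.
    by move=> fw; rewrite -extend_comp; congr extend; apply/funext => i /=.
  exists (x + a h); split; last split.
  - apply: ppos_extendD => //; have := ppos_hom a hp hph.
    by rewrite -extend_comp; congr (sat _ (extend _ _)); apply/funext => i /=; rewrite linear0.
  - move=> /(ppos_hom b hq); rewrite (E _ b _ (fun=> 0))//.
    by rewrite linearD bx add0r ab.
  (* The projection [r] onto the complement fixes the parameters and takes [x + a h] back to [x], so
     no other formula of the list becomes true. *)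
  - pose r : {linear M -> M} := idfun \- (a \o b).
    have rE : r (x + a h) = x by rewrite /= linearD bx add0r ab addrK.
    have rv i : r (v i) = v i by rewrite /= bv' linear0 subr0.
    move: nx hl; elim: l {IH} => [//|q' l IH'] /= [nq' nl] /andP[hq' hl].
    split; last exact: IH'.
    by move=> /(ppos_hom r hq'); rewrite (E _ r _ v)// rE.
move=> [x [sx nx]]; split; first by exists x.
elim: l hl nx => [//|q l IH] /= /andP[hq hl] [nq nl].
case: asboolP => [pq|_] /=; last exact: IH.
split; last exact: IH.
(* The difference [x - y] satisfies [p] with zero parameters, hence [q] by entailment; adding it to
   [y] yields [q] at [x]. *)
move=> [y [py qy]]; apply: nq; rewrite -(subrKC y x); apply: ppos_extendD => //.
by apply: eqflat_entails pq _ => //; exact: ppos_extendB py.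
Qed.

Lemma ppos_dnf_ex n (D : seq (clause n.+1)) :
  all (@ppos_clause n.+1) D -> all (@ppos_clause n) (map (@clause_ex n) D).
Proof.
rewrite all_map; apply: sub_all => -[p l] /andP[/= hp hl].
rewrite /ppos_clause /= hp all_map all_filter; apply: sub_all hl => q hq /=.
by rewrite hp hq implybT.
Qed.

Lemma sat_dnf_ex (M : lmodType R) n D (v : 'I_n -> M) :
  eqflat M -> roomy M -> all (@ppos_clause n.+1) D ->
  sat_dnf (map (@clause_ex n) D) v <-> exists x, sat_dnf D (extend x v).
Proof.
move=> fM rM; elim: D => [_|c D IH] /=; first by split=> // -[].
move=> /andP[hc hD]; rewrite IH// sat_clause_ex//; split.
  by move=> [[x h]|[x h]]; exists x; [left|right].
by move=> [x [h|h]]; [left|right]; exists x.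
Qed.

(** One list [D] serves all modules, as [clause_ex] refers to [F] only. A universal quantifier is
    treated as a negated existential one. *)
Theorem pp_elimination n (phi : formula R n) :
  exists2 D : seq (clause n), all (@ppos_clause n) D &
    forall M : lmodType R, eqflat M -> roomy M ->
    forall v : 'I_n -> M, sat phi v <-> sat_dnf D v.
Proof.
elim: phi => {n} [n t u|n p [D hD pD]|n p [D hD pD] q [D' hD' qD]
  |n p [D hD pD] q [D' hD' qD]|n p [D hD pD] q [D' hD' qD]|n p [D hD pD]|n p [D hD pD]].
- by exists [:: (fEq t u, [::])] => // M _ _ v; rewrite /= /sat_clause /=; tauto.
- exists (dnf_not D); first exact: ppos_dnf_not.
  by move=> M fM rM v; rewrite sat_dnf_not -pD.
- exists (dnf_and D D'); first exact: ppos_dnf_and.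
  by move=> M fM rM v; rewrite sat_dnf_and -pD// -qD.
- exists (D ++ D'); first by rewrite all_cat hD.
  by move=> M fM rM v; rewrite sat_dnf_cat -pD// -qD.
- exists (dnf_not D ++ D'); first by rewrite all_cat ppos_dnf_not.
  by move=> M fM rM v; rewrite sat_dnf_cat sat_dnf_not -pD// -qD//= implyE.
- exists (dnf_not (map (@clause_ex n) (dnf_not D))).
    exact/ppos_dnf_not/ppos_dnf_ex/ppos_dnf_not.
  move=> M fM rM v; rewrite sat_dnf_not sat_dnf_ex//; last exact: ppos_dnf_not.
  split=> [h [x]|h x] /=; first by rewrite sat_dnf_not -pD//; apply.
  by apply: contrapT => npx; apply: h; exists x; rewrite sat_dnf_not -pD.
- exists (map (@clause_ex n) D); first exact: ppos_dnf_ex.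
  by move=> M fM rM v; rewrite sat_dnf_ex//; split=> -[x h]; exists x; apply/pD.
Qed.

End Formulas.

(** * Flat models and embeddings *)

Lemma infinite_injection (T : Type) (A : set T) : infinite_set A ->
  exists2 j : nat -> T, injective j & forall n, A (j n).
Proof.
move=> /infiniteP/card_leP[f].
exists (fun n => val (f (to_setT n))) => [m n /val_inj fmn|n]; last exact: set_valP.
by have [] : to_setT m = to_setT n by apply: (@inj _ _ _ f) fmn; rewrite in_setE.
Qed.

Section Models.
Variable R : pzRingType.
Local Notation F := (freemod R nat).
Local Notation e := (@fbasis R nat).

(** The tuple has a finite joint support, and infinitely many basis elements remain outside it. *)
Lemma roomy_freemod K : infinite_set [set: K] -> roomy (freemod R K).
Proof.
move=> Kinf n v.
pose A := [set k : K | exists i : 'I_n, v i k <> 0].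
have Afin : finite_set A.
  rewrite (_ : A = \bigcup_(i in [set: 'I_n]) [set k | v i k <> 0]).
    apply: bigcup_finite => // i _; exact: (asboolW (freemod_valP (v i))).
  by apply/seteqP; split=> k [i]; exists i.
have [j jinj jA] := infinite_injection (infinite_setD Kinf Afin).
pose b := flift (fun k : K => if pselect (exists i, k = j i) is left h then e (sval (cid h))
  else 0).
have bj i : b (fbasis R (j i)) = e i.
  rewrite flift_basis; case: pselect => [h|[]]; last by exists i.
  by case: (cid h) => /= i' /jinj ->.
exists (flift (fun i => fbasis R (j i))), b; split=> [x|i].
  apply: (freemod_lin_ext (f := b \o flift _) (g := idfun)) => k /=.
  by rewrite flift_basis bj.
have [s us hs] := freemod_support (v i).
rewrite (freemod_sumE us hs) linear_sum big1// => k _; rewrite linearZ_LR flift_basis.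
case: pselect => [[l kl]|_]; last by rewrite scaler0.
have -> : v i k = 0; last by rewrite scale0r.
by apply: contrapT => vk; have [_ []] := jA l; exists i; rewrite -kl.
Qed.

Lemma roomy_prod (M N : lmodType R) : roomy N -> roomy (M * N)%type.
Proof.
move=> rN n v; have [a [b [ab bv]]] := rN n (snd \o v).
by exists (pair_inr M N \o a), (b \o snd); split=> [x|i]; [exact: ab|exact: bv].
Qed.

(** Positive primitive formulas hold at zero, so a clause holds there exactly when it negates
    nothing, whatever the module. *)
Lemma sat_dnf0 (M N : lmodType R) n (D : seq (clause R n)) : all (@ppos_clause R n) D ->
  sat_dnf D (fun=> 0 : M) <-> sat_dnf D (fun=> 0 : N).
Proof.
elim: D => [//|[p l] D IH] /= /andP[/andP[/= hp hl] /IH ->].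
suff -> : sat_clause (p, l) (fun=> 0 : M) <-> sat_clause (p, l) (fun=> 0 : N) by [].
have s0 (V : lmodType R) (q : formula R n) : ppos q -> sat q (fun=> 0 : V).
  by move=> ?; apply: ppos0.
rewrite /sat_clause /=; case: l hl => [|q l] /= => [_|/andP[hq _]].
  by have := s0 M p hp; have := s0 N p hp; tauto.
by have := s0 M q hq; have := s0 N q hq; tauto.
Qed.

Lemma eqflat_roomy_model (M : lmodType R) :
  eqflat M -> roomy M -> model_of (free_theory R) M.
Proof.
move=> fM rM phi /(_ nat infinite_nat); rewrite /models.
have [D hD DE] := pp_elimination phi.
rewrite !DE// => [||]; first by rewrite (sat_dnf0 F M).
  exact: eqflat_freemod.
exact/roomy_freemod/infinite_nat.
Qed.

Fixpoint universal_closure n : formula R n -> formula R 0 :=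
  match n with
  | 0%N => id
  | m.+1 => fun phi => universal_closure (fAll phi)
  end.

Lemma sat_universal_closure (M : lmodType R) n (phi : formula R n) :
  models M (universal_closure phi) <-> forall v : 'I_n -> M, sat phi v.
Proof.
elim: n phi => [|n IH] phi /=.
  by split=> [h v|h]; [rewrite (_ : v = fun=> 0)//; apply/funext => -[]|exact: h].
rewrite IH; split=> [h v|h v x] /=; last exact: h.
have := h (fun i => v (lift ord0 i)) (v ord0); congr sat; apply/funext => i.
by rewrite /extend; case: unliftP => [j|] ->.
Qed.

Definition none_formula n (l : seq (formula R n)) : formula R n :=
  foldr (fun psi q => fAnd (fNot psi) q) (fTrue R n) l.
Definition dnf_formula n (D : seq (clause R n)) : formula R n :=
  foldr (fun c q => fOr (fAnd c.1 (none_formula c.2)) q) (fNot (fTrue R n)) D.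

Lemma sat_dnf_formula (M : lmodType R) n D (v : 'I_n -> M) :
  sat (dnf_formula D) v <-> sat_dnf D v.
Proof.
elim: D => [|[p l] D IH] /=; first by tauto.
suff : sat (none_formula l) v <-> sat_none l v by rewrite /sat_clause /=; tauto.
by elim: l => [|q l IHl] /=; tauto.
Qed.

(** The equivalence of [phi] with [D] is itself expressed by a sentence true in all free modules of
    infinite rank, so it passes to every model. *)
Lemma model_elimination (M : lmodType R) n (phi : formula R n) D :
  model_of (free_theory R) M ->
  (forall N : lmodType R, eqflat N -> roomy N ->
    forall v : 'I_n -> N, sat phi v <-> sat_dnf D v) ->
  forall v : 'I_n -> M, sat phi v <-> sat_dnf D v.
Proof.
move=> mM DE v.
pose q := fAnd (fImp phi (dnf_formula D)) (fImp (dnf_formula D) phi).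
have : models M (universal_closure q).
  apply: mM => I Iinf; apply/sat_universal_closure => w; rewrite /= sat_dnf_formula.
  by rewrite -DE//; [exact: eqflat_freemod|exact: roomy_freemod].
by move=> /sat_universal_closure/(_ v); rewrite /= sat_dnf_formula; tauto.
Qed.

(** After elimination on both sides, only positive primitive formulas have to be compared; every
    linear map preserves them, and [f] reflects them. *)
Lemma model_elementary_embedding (M : lmodType R) K (f : {linear M -> freemod R K}) :
  infinite_set [set: K] -> model_of (free_theory R) M ->
  (forall n (phi : formula R n) v, ppos phi -> sat phi (f \o v) -> sat phi v) ->
  elementary_embedding f.
Proof.
move=> Kinf mM reflf n phi v; have [D hD DE] := pp_elimination phi.
rewrite (model_elimination mM DE) DE; [|exact: eqflat_freemod|exact: roomy_freemod].
have fE (p : formula R n) : ppos p -> sat p (f \o v) <-> sat p v.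
  by move=> hp; split; [exact: reflf|exact: ppos_hom].
elim: D hD {DE} => [//|[p l] D IH] /= /andP[/andP[/= hp hl] /IH ->].
suff : sat_none l (f \o v) <-> sat_none l v by rewrite /sat_clause /= fE//; tauto.
by elim: l hl => [//|q l IHl] /= /andP[hq /IHl ->]; rewrite fE.
Qed.

Lemma elementary_pure (M N : lmodType R) (f : {linear M -> N}) :
  elementary_embedding f -> pure_embedding f.
Proof.
move=> ef; split=> [x y fxy|n phi v _]; last exact: ef.
pose v (i : 'I_2) : M := if val i is 0%N then x else y.
by apply: (ef 2 (fEq (tVar R ord0) (tVar R (lift ord0 ord0))) v).1.
Qed.

Lemma split_reflects (M N : lmodType R) (f : {linear M -> N}) (g : {linear N -> M}) :
  cancel f g -> forall n (phi : formula R n) v, ppos phi -> sat phi (f \o v) -> sat phi v.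
Proof.
move=> fg n phi v hp /(ppos_hom g hp); congr sat.
by apply/funext => i; rewrite /= fg.
Qed.

(** The component [x] in a decomposition [y = f x + c] is unique, hence any choice of it is
    linear. *)
Lemma summand_retraction (M N : lmodType R) (f : {linear M -> N}) :
  summand_embedding f -> exists g : {linear N -> M}, cancel f g.
Proof.
move=> [finj [C [[C0 CP] decC disj]]].
have CD a x y : x \in C -> y \in C -> a *: x + y \in C by move=> *; apply: CP.
have [g gP] := choice decC.
have gE y x c : c \in C -> y = f x + c -> g y = x.
  move=> cC yE; have [d [dC yE']] := gP y; apply: finj.
  apply: subr0_eq; rewrite -linearB (disj (g y - x)) ?linear0//.
  have -> : f (g y - x) = (-1) *: d + c.
    rewrite linearB scaleN1r; apply: (addrI d); rewrite addNKr.
    by rewrite addrA [d + _]addrC -yE' yE addrC addKr.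
  exact: CD.
have glin : linear g.
  move=> a x y; have [c [cC xE]] := gP x; have [d [dC yE]] := gP y.
  apply: (gE _ _ (a *: c + d)); first exact: CD.
  by rewrite {1}xE {1}yE scalerDr linearPD addrACA.
exists (mklin glin) => x /=; apply: (gE _ _ 0) => //; by rewrite addr0.
Qed.

Lemma retraction_summand (M N : lmodType R) (f : {linear M -> N}) (g : {linear N -> M}) :
  cancel f g -> summand_embedding f.
Proof.
move=> fg; split; first exact: can_inj fg.
pose C : {pred N} := fun y => g y == 0.
have CE y : (y \in C) = (g y == 0) by [].
exists C; split.
- split=> [|a x y]; rewrite !CE ?linear0// => /eqP gx /eqP gy.
  by rewrite linearPD gx gy scaler0 addr0.
- move=> y; exists (g y), (y - f (g y)); split; last by rewrite addrC subrK.
  by rewrite CE linearB fg subrr.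
- by move=> x; rewrite CE fg => /eqP ->; rewrite linear0.
Qed.

Lemma split_pure (M N : lmodType R) (f : {linear M -> N}) (g : {linear N -> M}) :
  cancel f g -> pure_embedding f.
Proof.
move=> fg; split; first exact: can_inj fg.
move=> n phi v /pp_ppos hp; split; first exact: split_reflects fg _ _ _ hp.
exact: ppos_hom.
Qed.

Lemma summand_pure (M N : lmodType R) (f : {linear M -> N}) :
  summand_embedding f -> pure_embedding f.
Proof. by move=> /summand_retraction[g]; apply: split_pure. Qed.

Lemma generated_by_surjection (I : Type) (M : lmodType R) (q : {linear freemod R I -> M}) :
  (forall m, exists x, q x = m) ->
  generated_by_card I M /\ ([set: M] #<= [set: freemod R I])%card.
Proof.
move=> qsurj; split.
  exists [set q (fbasis R i) | i in [set: I]]; split; first exact: card_image_le.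
  move=> P [P0 PP] PS m; have [x <-] := qsurj m.
  elim/freemod_ind: x => [|a k x IH]; first by rewrite linear0.
  by rewrite linearPD; apply: PP => //; apply: PS; exists k.
rewrite (_ : [set: M] = q @` [set: freemod R I]); first exact: card_image_le.
by apply/seteqP; split=> // m _; have [x <-] := qsurj m; exists x.
Qed.

Lemma surjection_of_generated (I : Type) (M : lmodType R) : generated_by_card I M ->
  exists q : {linear freemod R I -> M}, forall m, exists x, q x = m.
Proof.
move=> [S [SI genS]].
have [s sP] : exists s : I -> M, forall m, S m -> exists i, s i = m.
  have /card_leP[f] := SI.
  (* This inverts the injection of [S] into [I], with value 0 outside its image. *)
  exists (fun i => if pselect (exists m : S, val (f m) = i) is left h then val (sval (cid h))
    else 0).
  move=> m Sm; pose m' : S := SigSub (mem_set Sm).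
  exists (val (f m')); case: pselect => [h|[]]; last by exists m'.
  case: (cid h) => /= p /val_inj fp; have -> // : p = m'.
  by apply: (@inj _ _ _ f) fp; rewrite in_setE.
exists (flift s) => m.
suff /asboolP : m \in [pred m | `[< exists x, flift s x = m >]] by [].
apply: genS => [|{}m /sP[i <-]]; last by apply/asboolP; exists (fbasis R i); rewrite flift_basis.
split=> [|a _ _ /asboolP[x <-] /asboolP[y <-]]; apply/asboolP.
  by exists 0; rewrite linear0.
by exists (a *: x + y); rewrite linearPD.
Qed.

Lemma projective_split (I : Type) (M : lmodType R) : projective M -> generated_by_card I M ->
  exists (f : {linear M -> freemod R I}) (g : {linear freemod R I -> M}), cancel f g.
Proof.
move=> pM /surjection_of_generated[q qsurj].
by have [f fq] := pM _ _ q idfun qsurj; exists f, q.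
Qed.

End Models.

(** * Linear systems as positive primitive formulas *)

Section LinearSystems.
Variable R : pzRingType.

Definition join (M : Type) m n (w : 'I_m -> M) (v : 'I_n -> M) : 'I_(m + n) -> M :=
  fun i => match fintype.split i with inl j => w j | inr k => v k end.

Lemma join_lshift (M : Type) m n (w : 'I_m -> M) (v : 'I_n -> M) j :
  join w v (lshift n j) = w j.
Proof. by rewrite /join -[lshift n j]/(unsplit (inl j)) unsplitK. Qed.

Lemma join_rshift (M : Type) m n (w : 'I_m -> M) (v : 'I_n -> M) j :
  join w v (rshift m j) = v j.
Proof. by rewrite /join -[rshift m j]/(unsplit (inr j)) unsplitK. Qed.

Lemma extend_join (M : Type) m n (x : M) (w : 'I_m -> M) (v : 'I_n -> M) :
  extend x (join w v) = join (extend x w) v.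
Proof.
apply/funext => i; case: (split_ordP (i : 'I_(m.+1 + n))) => j ->; last first.
  rewrite join_rshift (_ : rshift m.+1 j = lift ord0 (rshift m j)); last exact: val_inj.
  by rewrite /extend liftK /= join_rshift.
rewrite join_lshift; case: (unliftP ord0 j) => [k ->|->].
  rewrite (_ : lshift n (lift ord0 k) = lift ord0 (lshift n k)); last exact: val_inj.
  by rewrite /extend !liftK /= join_lshift.
by rewrite (_ : lshift n ord0 = ord0) ?/extend ?unlift_none//; exact: val_inj.
Qed.

Lemma extend_eta (M : Type) n (v : 'I_n.+1 -> M) :
  v = extend (v ord0) (fun i => v (lift ord0 i)).
Proof. by apply/funext => i; rewrite /extend; case: unliftP => [j|] ->. Qed.

Fixpoint ex_block m n : formula R (m + n) -> formula R n :=
  match m with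
  | 0%N => id
  | k.+1 => fun phi => ex_block (fEx phi)
  end.

Lemma pp_ex_block m n (phi : formula R (m + n)) : pp phi -> pp (ex_block phi).
Proof. by elim: m phi => //= m IH phi hp; apply: IH. Qed.

Lemma sat_ex_block (M : lmodType R) m n (phi : formula R (m + n)) (v : 'I_n -> M) :
  sat (ex_block phi) v <-> exists w : 'I_m -> M, sat phi (join w v).
Proof.
elim: m phi => [|m IH] phi /=.
  have jv (w : 'I_0 -> M) : join w v = v.
    apply/funext => i; rewrite -[RHS](join_rshift w v i).
    by congr (join w v _); exact: val_inj.
  by split=> [h|[w]]; [exists (fun=> 0); rewrite jv|rewrite jv].
rewrite IH /=; split=> [[w [x h]]|[w h]]; first by exists (extend x w); rewrite -extend_join.
by exists (fun i => w (lift ord0 i)), (w ord0); rewrite extend_join -extend_eta.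
Qed.

(** Membership in the image of a matrix over [R] is the property that purity will transfer from the
    free module back to the colimit. *)
Lemma pp_system n m (A : 'I_n -> 'I_m -> R) :
  exists2 phi : formula R n, pp phi &
    forall (M : lmodType R) (v : 'I_n -> M),
      sat phi v <-> exists w : 'I_m -> M, forall i, v i = \sum_j A i j *: w j.
Proof.
pose lin k (s : seq (R * 'I_k)) :=
  foldr (fun p t => tAdd (tScale p.1 (tVar R p.2)) t) (tZero R k) s.
have linE k s (M : lmodType R) (v : 'I_k -> M) :
    eval v (lin k s) = \sum_(p <- s) p.1 *: v p.2.
  by elim: s => [|p s IH]; rewrite ?(big_nil, big_cons) //= IH.
pose eqn i := fEq (tVar R (rshift m i)) (lin _ [seq (A i j, lshift n j) | j : 'I_m <-
  index_enum 'I_m]).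
have eqnE i (M : lmodType R) (w : 'I_m -> M) (v : 'I_n -> M) :
    sat (eqn i) (join w v) <-> v i = \sum_j A i j *: w j.
  rewrite /= join_rshift linE big_map /=.
  by under eq_bigr do rewrite join_lshift.
pose conj := foldr (fun i q => fAnd (eqn i) q) (fTrue R _) (enum 'I_n).
exists (ex_block conj).
  apply: pp_ex_block; suff : eq_conj conj by case: conj.
  by rewrite /conj; elim: (enum _) => //= i s ->.
move=> M v; rewrite sat_ex_block.
suff E w : sat conj (join w v) <-> forall i, v i = \sum_j A i j *: w j.
  by split=> -[w] /E h; exists w.
have -> : sat conj (join w v) <-> forall i, i \in enum 'I_n -> sat (eqn i) (join w v).
  rewrite /conj; elim: (enum _) => [|i s IH]; first by split.
  rewrite [sat _ _]/= -/(sat (eqn i) _) IH; split=> [[hi hs] j|h].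
    by rewrite in_cons => /predU1P[->|/hs].
  by split=> [|j js]; apply: h; rewrite in_cons ?eqxx// js orbT.
by split=> h i; [apply/eqnE/h; rewrite mem_enum|move=> _; apply/eqnE].
Qed.

End LinearSystems.

(** * Sequential colimits *)

Lemma eventually_ord n (P : 'I_n -> nat -> Prop) :
  (forall i, exists K, forall k, (K <= k)%N -> P i k) ->
  exists K, forall k, (K <= k)%N -> forall i, P i k.
Proof.
move=> /choice[K hK]; exists (\max_i K i)%N => k kK i; apply: hK.
exact: leq_trans (leq_bigmax i) kK.
Qed.

Section Colimit.
Variables (R : pzRingType) (sigma : nat -> {linear freemod R nat -> freemod R nat}).
Local Notation F := (freemod R nat).
Local Notation e := (@fbasis R nat).

(** The colimit is presented as the eventually compatible sequences modulo the eventually zero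
    ones. *)
Definition compatible (x : nat -> F) :=
  exists K, forall k, (K <= k)%N -> x k.+1 = sigma k (x k).
Definition vanishing (x : nat -> F) := exists K, forall k, (K <= k)%N -> x k = 0.

Lemma compatible_submod : is_submod compatible.
Proof.
split=> [|a x y [K hx] [L hy]]; first by exists 0%N => k _; rewrite linear0.
exists (maxn K L) => k; rewrite geq_max => /andP[/hx xk /hy yk].
by rewrite !fctE xk yk linearPD.
Qed.

Lemma vanishing_submod : is_submod vanishing.
Proof.
split=> [|a x y [K hx] [L hy]]; first by exists 0%N.
exists (maxn K L) => k; rewrite geq_max => /andP[/hx xk /hy yk].
by rewrite !fctE xk yk scaler0 addr0.
Qed.

Definition colimit := subquo compatible_submod vanishing_submod.
HB.instance Definition _ := GRing.Lmodule.on colimit.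
Local Notation mk := (subquo_mk compatible_submod vanishing_submod).

Definition colim_val (g : colimit) : nat -> F :=
  @subquo_val _ _ _ _ compatible_submod vanishing_submod g.
Lemma colim_val_in g : compatible (colim_val g).
Proof. exact: (@subquo_val_in _ _ _ _ compatible_submod vanishing_submod g). Qed.
Lemma colim_valK g : mk (colim_val g) = g.
Proof. exact: subquo_valK. Qed.

(** The sequence that is zero before stage [k], equals [x] there and follows the maps [sigma]
    afterwards; it represents the image of [x] in the colimit. *)
Fixpoint thread (k : nat) (x : F) (j : nat) : F :=
  match j with
  | 0%N => if k == 0%N then x else 0
  | i.+1 => if k == i.+1 then x else sigma i (thread k x i)
  end.

Lemma threadS k x j : (k <= j)%N -> thread k x j.+1 = sigma j (thread k x j).
Proof. by rewrite -ltnS /= ltn_neqAle => /andP[/negbTE ->]. Qed.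

Lemma thread_eq k x : thread k x k = x.
Proof. by case: k => [|k] /=; rewrite ?eqxx. Qed.

Lemma thread_compatible k x : compatible (thread k x).
Proof. by exists k => j; exact: threadS. Qed.

Lemma threadPD k a x y : thread k (a *: x + y) = a *: thread k x + thread k y.
Proof.
apply/funext; elim=> [|j IH]; rewrite !fctE /=; first by case: eqP; rewrite ?scaler0 ?addr0.
by case: eqP => // _; rewrite IH !fctE linearPD.
Qed.

Lemma thread_unique k (y : nat -> F) :
  (forall j, (k <= j)%N -> y j.+1 = sigma j (y j)) ->
  forall j, (k <= j)%N -> thread k (y k) j = y j.
Proof.
move=> hy j /subnKC <-; elim: (j - k)%N => [|i IH]; first by rewrite addn0 thread_eq.
by rewrite addnS threadS ?leq_addr// IH hy// leq_addr.
Qed.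

Lemma colim_in_linear k : linear (fun x => mk (thread k x) : colimit).
Proof. by move=> a x y; rewrite threadPD subquo_mkPD//; exact: thread_compatible. Qed.
Definition colim_in k : {linear F -> colimit} := mklin (colim_in_linear k).

Lemma colim_mk k (y : nat -> F) : (forall j, (k <= j)%N -> y j.+1 = sigma j (y j)) ->
  mk y = colim_in k (y k).
Proof.
move=> hy; apply: subquo_mk_eq; [by exists k|exact: thread_compatible|].
by exists k => j kj; rewrite !fctE thread_unique// subrr.
Qed.

Lemma colim_inS k x : colim_in k.+1 (sigma k x) = colim_in k x.
Proof.
have h j : (k.+1 <= j)%N -> thread k x j.+1 = sigma j (thread k x j).
  by move=> kj; apply/threadS/ltnW.
by rewrite -[RHS]/(mk (thread k x) : colimit) (colim_mk h) threadS// thread_eq.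
Qed.

Lemma colim_surj (g : colimit) : exists k x, g = colim_in k x.
Proof.
have [K hK] := colim_val_in g; exists K, (colim_val g K).
by rewrite -colim_mk// colim_valK.
Qed.

(** Finitely many elements are represented at a common stage, and a relation between them holds from
    some stage on; at such a stage they factor through [F]. *)
Lemma eqflat_colimit : eqflat colimit.
Proof.
apply: eqflat_local => y N u uN yu.
pose x i := colim_val (y i).
have [K hK] := @eventually_ord N (fun i k => forall j, (k <= j)%N -> x i j.+1 = sigma j (x i j))
  (fun i => let: ex_intro K h := colim_val_in (y i) in
            ex_intro _ K (fun k Kk j kj => h j (leq_trans Kk kj))).
have yE k (i : 'I_N) : (K <= k)%N -> y i = colim_in k (x i k).
  by move=> /hK h; rewrite -colim_mk ?colim_valK//; exact: h.
have [Ux mkx] := subquo_mk_sum compatible_submod vanishing_submod (index_enum 'I_N) (fun i => u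
  i) (fun i : 'I_N => colim_val_in (y i)).
have [L hL] : vanishing (\sum_(i < N) (u i : R) *: x i).
  apply/(subquo_mk_eq0 compatible_submod vanishing_submod Ux); rewrite mkx.
  rewrite -[RHS]yu -[in RHS]uN trunc_sum linear_sum; apply: eq_bigr => i _.
  by rewrite linearZ_LR flift_basis colim_valK.
pose k := maxn K L; exists (flift (fun i => x i k)), (colim_in k); split=> [i iN|].
  by rewrite flift_basis -(yE k (Ordinal iN)) ?leq_maxl.
rewrite -uN trunc_sum linear_sum -[RHS](hL k) ?leq_maxr// fct_sumE.
by apply: eq_bigr => i _; rewrite linearZ_LR flift_basis.
Qed.

Fixpoint composite (k : nat) : {linear F -> F} :=
  match k with
  | 0%N => idfun
  | i.+1 => sigma i \o composite i
  end.

Lemma composite_thread k x : composite k x = thread 0 x k.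
Proof. by elim: k => //= k ->. Qed.

Lemma colim_in_composite k x : colim_in k (composite k x) = colim_in 0 x.
Proof. by elim: k => // k <-; exact: colim_inS. Qed.

End Colimit.

(** [I] has enough indices for the generators [colim_in k (e j)] of a colimit together with a basis
    of [freemod R I]. *)
Lemma infinite_surjection (I : Type) : infinite_set [set: I] ->
  exists r : I -> nat * nat + I, forall y, exists i, r i = y.
Proof.
move=> /infinite_injection[j jinj _].
(* In a countable part of [I], the even places enumerate the pairs, with (0, 0) where [unpickle]
   fails, and the odd places recover that part itself; the rest of [I] is fixed. *)
pose f n : nat * nat + I := if odd n then inr (j n./2) else inl (odflt (0, 0)%N (unpickle n./2)).
pose r i := if pselect (exists n, i = j n) is left h then f (sval (cid h)) else inr i.
have rj n : r (j n) = f n.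
  by rewrite /r; case: pselect => [h|[]]; [case: (cid h) => /= m /jinj ->|exists n].
exists r => -[p|i].
  by exists (j (pickle p).*2); rewrite rj /f odd_double doubleK pickleK.
have [[n ->]|ni] := pselect (exists n, i = j n).
  by exists (j n.*2.+1); rewrite rj /f /= odd_double uphalf_double.
by exists i; rewrite /r; case: pselect.
Qed.

(** * Stabilization from pure universality *)

Section Stabilization.
Variable R : pzRingType.
Local Notation F := (freemod R nat).
Local Notation e := (@fbasis R nat).

Lemma fst_sum (M N : lmodType R) I (r : seq I) (a : I -> R) (w : I -> (M * N)%type) :
  (\sum_(i <- r) a i *: w i).1 = \sum_(i <- r) a i *: (w i).1.
Proof. by elim: r => [|i r IH]; rewrite ?big_nil ?big_cons //= IH. Qed.

Lemma colimit_surjection (sigma : nat -> {linear F -> F}) (I : Type) : infinite_set [set: I] ->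
  exists q : {linear freemod R I -> (colimit sigma * freemod R I)%type},
    forall m, exists x, q x = m.
Proof.
move=> /infinite_surjection[r rsurj].
pose y i : (colimit sigma * freemod R I)%type := match r i with
  | inl (k, j) => (colim_in sigma k (e j), 0) | inr j => (0, fbasis R j) end.
exists (flift y) => -[g f].
have [x xE] : exists x, flift y x = (g, 0).
  have [k [u ->]] := colim_surj g.
  elim/freemod_ind: u => [|a j u [x xE]]; first by exists 0; rewrite !linear0.
  have [i ri] := rsurj (inl (k, j)); exists (a *: fbasis R i + x).
  rewrite linearPD xE flift_basis /y ri linearPD.
  by apply/pair_equal_spec; rewrite /= scaler0 addr0.
have [x' xE'] : exists x, flift y x = (0, f).
  elim/freemod_ind: f => [|a j u [x' xE']]; first by exists 0; rewrite !linear0.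
  have [i ri] := rsurj (inr j); exists (a *: fbasis R i + x').
  rewrite linearPD xE' flift_basis /y ri.
  by apply/pair_equal_spec; rewrite /= scaler0 addr0.
exists (x + x'); rewrite linearD xE xE'.
by apply/pair_equal_spec; rewrite /= addr0 add0r.
Qed.

(* The descending chain of right submodules Hom(F, R) o composite k o trunc n
   of Hom(R^n, R) = R^n stabilizes. *)
Definition stabilizing := forall (sigma : nat -> {linear F -> F}) (n : nat),
  exists k (tau : {linear F -> F}), forall x,
    tau (sigma k (composite sigma k (trunc n x))) = composite sigma k (trunc n x).

Lemma pure_universal_stabilizing (I : Type) : infinite_set [set: I] ->
  universal (@pure_embedding R) (generated_flat_model I) (freemod R I) -> stabilizing.
Proof.
move=> Iinf univ sigma n; pose M := (colimit sigma * freemod R I)%type.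
have [q qsurj] := colimit_surjection sigma Iinf.
have [genM cardM] := generated_by_surjection qsurj.
have fM : eqflat M by apply: eqflat_prod; [exact: eqflat_colimit|exact: eqflat_freemod].
have KM : generated_flat_model I M.
  split=> //; first exact: eqflat_flat.
  by apply: eqflat_roomy_model => //; apply/roomy_prod/roomy_freemod.
have [f [finj fpure]] := univ _ KM cardM.
pose inl0 := pair_inl (colimit sigma) (freemod R I).
pose eta k : {linear F -> freemod R I} := f \o (inl0 \o colim_in sigma k).
(* The images under [f] of the first [n] generators lie in a free summand of rank [m]; their
   coordinates there form the matrix of [phi]. *)
have [m [b [c [bc cm]]]] := freemod_local_retract (fun i => eta 0%N (e i)) n.
have [phi ppphi phiE] := pp_system (fun (i : 'I_n) (j : 'I_m) => (c (eta 0%N (e i)) : F) j : R).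
pose v (i : 'I_n) : M := inl0 (colim_in sigma 0 (e i)).
have : sat phi (f \o v).
  apply/phiE; exists (fun j => b (e j)) => i.
  transitivity (b (c (eta 0%N (e i)))); first by rewrite bc.
  exact: trunc_lin_sum.
(* By purity the combinations exist in [M] itself; their components in the colimit satisfy the
   equations from some stage on. *)
move=> /(fpure _ phi v ppphi)/phiE[w wE].
pose x (j : 'I_m) := colim_val (w j).1.
have eqn (i : 'I_n) : vanishing (thread sigma 0 (e i) - \sum_(j < m) ((c (eta 0%N (e i)) : F) j
  : R) *: x j).
  have [Ux mkx] := subquo_mk_sum (compatible_submod sigma) (vanishing_submod R) (index_enum 'I_m)
     (fun j : 'I_m => (c (eta 0%N (e i)) : F) j : R) (fun j : 'I_m => colim_val_in (w j).1).
  apply/(subquo_mk_eq0 (compatible_submod sigma) (vanishing_submod R)).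
    by apply: (submodB (compatible_submod sigma)) => //; exact: thread_compatible.
  rewrite -scaleN1r addrC subquo_mkPD//; last exact: thread_compatible.
  have := congr1 fst (wE i); rewrite fst_sum => /= vi.
  rewrite mkx scaleN1r addrC; apply/eqP; rewrite subr_eq0; apply/eqP/(etrans vi).
  by apply: eq_bigr => j _; rewrite colim_valK.
have [k hk] : exists k, forall i : 'I_n, composite sigma k (e i) = \sum_(j < m) ((c (eta 0%N (e
  i)) : F) j : R) *: x j k.
  have [k hk] := eventually_ord eqn; exists k => i.
  rewrite composite_thread; apply: subr0_eq; rewrite -[RHS](hk k (leqnn k) i).
  by rewrite !fctE fct_sumE.
pose W : {linear F -> F} := flift (fun j => oapp (fun j' : 'I_m => x j' k) 0 (insub j)).
(* Passing from stage [k.+1] to the colimit gives the same element as stage 0; [c] then reads its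
   coordinates and [W] rebuilds the element of stage [k] from them. *)
exists k, (W \o (c \o eta k.+1)) => y.
rewrite -[LHS]/(W (c (f (inl0 (colim_in sigma k.+1 (sigma k (composite sigma k (trunc n y)))))))).
rewrite colim_inS colim_in_composite.
apply: (trunc_lin_ext (n := n) (f := W \o (c \o eta 0%N)) (g := composite sigma k));
  last exact: trunc_trunc.
move=> i iN /=; rewrite (hk (Ordinal iN)) (trunc_lin_sum _ (cm _)); apply: eq_bigr => j _.
by rewrite flift_basis valK.
Qed.

End Stabilization.

(** * Extending partial lifts *)

Section Chains.
Variable R : pzRingType.
Local Notation F := (freemod R nat).
Hypothesis stab : stabilizing R.
Variables (M : lmodType R) (N : set M).
Hypothesis HN : is_submod N.

Let ND x y : N x -> N y -> N (x + y). Proof. exact: (submodD HN). Qed.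

(** If every representation of [y] on the first [n] basis vectors had a refinement from which it
    cannot be recovered, dependent choice would produce a sequence contradicting [stab]. *)
Lemma stable_factorization n (y : {linear F -> M}) :
  exists (s : {linear F -> F}) (y1 : {linear F -> M}),
    (forall x, N (y (trunc n x) - y1 (s (trunc n x)))) /\
    forall (S : {linear F -> F}) (z : {linear F -> M}), (forall x, N (y1 x - z (S x))) ->
      exists T : {linear F -> F}, forall x, T (S (s (trunc n x))) = s (trunc n x).
Proof.
apply: contrapT => unstable.
pose good (p : {linear F -> F} * {linear F -> M}) :=
  forall x, N (y (trunc n x) - p.2 (p.1 (trunc n x))).
have step (p : {p | good p}) : exists q : {linear F -> F} * {p | good p},
    (sval q.2).1 = (q.1 \o (sval p).1) /\
    ~ exists T : {linear F -> F}, forall x, T (q.1 ((sval p).1 (trunc n x))) = (sval p).1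
      (trunc n x).
  case: p => -[s y1] /= sy; apply: contrapT => nq; apply: unstable; exists s, y1.
  split=> // S z hz; apply: contrapT => nT; apply: nq.
  pose q : {linear F -> F} * {linear F -> M} := (S \o s : {linear F -> F}, z).
  have gz : good q.
    move=> x /=; rewrite -(subrK (y1 (s (trunc n x))) (y _)) -addrA.
    by apply: ND; [exact: sy|exact: hz].
  by exists (S, exist _ q gz).
have [next nextP] := choice step.
pose q0 : {linear F -> F} * {linear F -> M} := (idfun : {linear F -> F}, y).
have good0 : good q0 by move=> x /=; rewrite subrr; exact: HN.1.
pose p k := iter k (fun p => (next p).2) (exist _ q0 good0).
(* The composites of the refinements are the successive representations, so [stab] reverses one of
   the irreversible steps. *)
pose sigma k := (next (p k)).1.
have cE k x : composite sigma k x = (sval (p k)).1 x.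
  by elim: k => //= k IH; rewrite (nextP (p k)).1 /= IH.
have [k [tau htau]] := stab sigma n.
by have [_ []] := nextP (p k); exists tau => x; rewrite -cE htau.
Qed.

(** Minimal representations are iterated; the image of [D k] involves finitely many basis vectors,
    and [n k.+1] bounds those to be represented next. *)
Lemma stable_chain (y0 : {linear F -> M}) (n0 : nat) :
  exists (Y : nat -> {linear F -> M}) (n : nat -> nat) (D : nat -> {linear F -> F}),
    [/\ Y 0%N = y0 /\ n 0%N = n0,
        forall k x, N (Y k (trunc (n k) x) - Y k.+1 (D k x)),
        forall k x, trunc (n k.+1) (D k x) = D k x
      & forall k (S : {linear F -> F}) (z : {linear F -> M}),
          (forall x, N (Y k.+1 x - z (S x))) ->
          exists T : {linear F -> F}, forall x, T (S (D k x)) = D k x].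
Proof.
have step (p : {linear F -> M} * nat) : exists q : {linear F -> F} * ({linear F -> M} * nat),
    [/\ forall x, N (p.1 (trunc p.2 x) - q.2.1 (q.1 x)),
        forall x, trunc q.2.2 (q.1 x) = q.1 x
      & forall (S : {linear F -> F}) (z : {linear F -> M}),
          (forall x, N (q.2.1 x - z (S x))) ->
          exists T : {linear F -> F}, forall x, T (S (q.1 x)) = q.1 x].
  case: p => y n; have [s [y1 [hy hs]]] := stable_factorization n y.
  have [m hm] := trunc_image_ex s n.
  by exists (s \o trunc n : {linear F -> F}, (y1, m)); split.
have [next nextP] := choice step.
pose p k := iter k (fun p => (next p).2) (y0, n0).
exists (fun k => (p k).1), (fun k => (p k).2), (fun k => (next (p k)).1).
by split=> // k; have [] := nextP (p k).
Qed.

End Chains.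

Section PartialLifts.
Variable R : pzRingType.
Local Notation F := (freemod R nat).
Local Notation e := (@fbasis R nat).
Hypothesis stab : stabilizing R.
Variables (M A B : lmodType R) (f : {linear A -> B}) (g : {linear M -> B}).
Hypothesis fsurj : forall b, exists a, f a = b.
Implicit Type H : set (M * A)%type.

Definition dom H : set M := [set m | exists a, H (m, a)].

(** [H] is the graph of a linear lift of [g] through [f] on the submodule [dom H]. Flatness of the
    quotient by [dom H] is kept as an invariant, since the extension step depends on it. *)
Record partial_lift H : Prop := PartialLift {
  pl_submod : is_submod H;
  pl_lift : forall m a, H (m, a) -> f a = g m;
  pl_fun : forall a, H (0, a) -> a = 0;
  pl_flat : eqflat_mod (dom H) }.

Lemma dom_submod H : is_submod H -> is_submod (dom H).
Proof.
move=> [H0 HP]; split; first by exists 0.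
by move=> r x y [a xa] [b yb]; exists (r *: a + b); exact: (HP r (x, a) (y, b)).
Qed.

Section Extension.
Variable H : set (M * A)%type.
Hypothesis HH : partial_lift H.
Let N := dom H.
Let HN : is_submod N := dom_submod (pl_submod HH).
Variables (Y : nat -> {linear F -> M}) (n : nat -> nat) (D : nat -> {linear F -> F}).
Hypothesis YD : forall k x, N (Y k (trunc (n k) x) - Y k.+1 (D k x)).
Hypothesis truncD : forall k x, trunc (n k.+1) (D k x) = D k x.
Hypothesis Dstab : forall k (S : {linear F -> F}) (z : {linear F -> M}),
  (forall x, N (Y k.+1 x - z (S x))) ->
  exists T : {linear F -> F}, forall x, T (S (D k x)) = D k x.

(** The discrepancy between successive representations; it lies in [N], where [H] already provides a
    lift. *)
Let nu k : {linear F -> M} := (Y k \o trunc (n k)) \- (Y k.+1 \o D k).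

Lemma chain_retractions :
  exists T : nat -> {linear F -> F}, forall k x, T k (D k.+1 (D k x)) = D k x.
Proof.
suff h k : exists T : {linear F -> F}, forall x, T (D k.+1 (D k x)) = D k x.
  by have [T hT] := choice h; exists T.
(* [D k.+1] factors only the truncation of [Y k.+1]. The remaining basis vectors go to a second copy
   of [F] and contribute nothing on the image of [D k]. *)
pose S : {linear F -> F} := (evens \o D k.+1) \+ (odds \o (idfun \- trunc (n k.+1))).
have [x|T hT] := @Dstab k S (copair (Y k.+2) (Y k.+1)).
  rewrite linearD copair_evens copair_odds linearB opprD opprB addrCA subrKC addrC.
  exact: YD.
exists (T \o evens) => x; rewrite -[RHS]hT /= truncD subrr linear0 addr0.
by [].
Qed.

(* The lifting on the image of [Y k] is corrected by a map that vanishes on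
   what has been lifted before, so that the lifts agree along the chain. *)
Lemma chain_lifts : exists c : nat -> {linear F -> A},
  [/\ forall k x, f (c k x) = g (Y k (trunc (n k) x)),
      forall k x, H (nu k x, c k x - c k.+1 (D k x))
    & forall k x, D k x = 0 -> H (nu k x, c k x)].
Proof.
have [H0 HP] := pl_submod HH.
have /choice[hn hnP] k : exists h : {linear F -> A}, forall x, H (nu k x, h x).
  apply: (freemod_choice (P := fun x a => H (nu k x, a))) => [|r x a y b xa yb|x].
  - by rewrite linear0.
  - rewrite linearPD; exact: (HP r (nu k x, a) (nu k y, b)).
  - exact: YD.
have /choice[a aP] k : exists h : {linear F -> A}, forall x, f (h x) = g (Y k x).
  exact: (@freemod_projective R nat A B f (g \o Y k) fsurj).
have [T hT] := chain_retractions.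
(* If [b] lifts [g \o Y k.+1], then [f] kills this mismatch, so adding it through [T k] leaves a
   lift; and [T k] recovers [D k x] from its next image, which makes the lifts agree there. *)
pose delta k (b : {linear F -> A}) : {linear F -> A} :=
  ((b \o trunc (n k.+1)) \- (a k.+2 \o D k.+1)) \- hn k.+1.
pose fix al (k : nat) : {linear F -> A} :=
  match k with
  | 0%N => a 1%N
  | j.+1 => a j.+2 \+ (delta j (al j) \o T j)
  end.
have alE k x : al k.+1 x = a k.+2 x +
    (al k (trunc (n k.+1) (T k x)) - a k.+2 (D k.+1 (T k x)) - hn k.+1 (T k x)) by [].
have alP k x : f (al k x) = g (Y k.+1 x).
  elim: k x => [|k IH] x; first exact: aP.
  rewrite alE linearD !(linearB f) IH !aP (pl_lift HH (hnP k.+1 _)).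
  by rewrite /= linearB subrr addr0.
pose c k : {linear F -> A} := (al k \o D k) \+ hn k.
have cE k x : c k x = al k (D k x) + hn k x by [].
exists c; split=> [k x|k x|k x Dx].
- by rewrite cE linearD alP (pl_lift HH (hnP _ _)) -linearD /= addrC subrK.
- have alS : al k.+1 (D k.+1 (D k x)) = al k (D k x) - hn k.+1 (D k x).
    rewrite alE hT truncD.
    by rewrite addrC addrAC subrK.
  by rewrite !cE alS subrK addrC addKr; exact: hnP.
- by rewrite cE Dx linear0 add0r; exact: hnP.
Qed.

(** The new graph is the union of the graphs of the [c k], each enlarged by [H]. These increase with
    [k] by the compatibility of the lifts. *)
Lemma chain_extension : exists H', [/\ partial_lift H', H `<=` H' &
  forall k x, dom H' (Y k (trunc (n k) x))].
Proof.
have [c [cP cS c0]] := chain_lifts.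
have SH := pl_submod HH; have [H0 HP] := SH.
pose p k u : (M * A)%type := (Y k (trunc (n k) u), c k u).
have pPD k a u v : p k (a *: u + v) = a *: p k u + p k v.
  by apply/pair_equal_spec; rewrite /= !linearPD.
have p0 k : p k 0 = 0 by apply/pair_equal_spec; rewrite /= !linear0.
have pS k u : H (p k u - p k.+1 (D k u)).
  by rewrite /p truncD; exact: cS.
have praise k j u : (k <= j)%N -> exists v, H (p k u - p j v).
  move=> /subnKC <-; elim: (j - k)%N => [|i [v hv]].
    by exists u; rewrite addn0 subrr.
  exists (D (k + i)%N v); rewrite addnS -(subrK (p (k + i)%N v) (p k u)) -addrA.
  exact: (submodD SH).
pose H' : set (M * A)%type := [set q | exists k u, H (q - p k u)].
have H'sub : H `<=` H'.
  by move=> q hq; exists 0%N, 0; rewrite p0 subr0.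
have domH' m : dom H' m <-> exists k u, N (m - Y k (trunc (n k) u)).
  split=> [[a [k [u h]]]|[k [u [b h]]]]; first by exists k, u, (a - c k u).
  by exists (b + c k u), k, u; rewrite (_ : _ - _ = (m - Y k (trunc (n k) u), b))//;
    apply/pair_equal_spec; rewrite /= addrK.
exists H'; split=> //; last first.
  by move=> k x; apply/domH'; exists k, x; rewrite subrr; exact: HN.1.
split.
- split=> [|a q q' [k [u hq]] [l [v hq']]]; first exact: H'sub.
  have [u' hu] := praise k (maxn k l) u (leq_maxl _ _).
  have [v' hv] := praise l (maxn k l) v (leq_maxr _ _).
  exists (maxn k l), (a *: u' + v').
  rewrite pPD opprD addrACA -scalerBr; apply: HP.
    by rewrite -(subrK (p k u) q) -addrA; exact: (submodD SH).
  by rewrite -(subrK (p l v) q') -addrA; exact: (submodD SH).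
- move=> m a [k [u /(pl_lift HH)]] /=.
  by rewrite !linearB cP => /subIr.
(* Single-valuedness: flatness gives an [S] that kills [D k u], while stability makes [S] injective
   on the image of [D k]. So [D k u] is zero, and [c k u] is then the value prescribed by [H]. *)
- move=> a [k [u h]].
  have Yn : N (Y k (trunc (n k) u)).
    have : N (0 - Y k (trunc (n k) u)) by exists (a - c k u).
    by move=> /(submodN HN); rewrite sub0r opprK.
  have YDn : N (Y k.+1 (D k u)).
    rewrite -(subKr (Y k (trunc (n k) u)) (Y k.+1 _)); apply: (submodB HN) => //; exact: YD.
  have [S [z [hz SD]]] := pl_flat HH YDn.
  have [T hT] := Dstab hz.
  have Du : D k u = 0 by rewrite -hT SD linear0.
  have := c0 k u Du => hc; apply: (pl_fun HH).
  have := submodD SH h hc; congr H; apply/pair_equal_spec; by rewrite /= Du linear0 subr0 !subrK.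
(* Flatness modulo the new domain: the relation is rewritten modulo [N] as [z u] = [Y k.+1 (D k v)],
   to which flatness modulo [N] applies. *)
- move=> z u /domH'[k [v zu]].
  have zu' : N (copair z (Y k.+1) (evens u - odds (D k v))).
    rewrite linearB copair_evens copair_odds -(subrK (Y k (trunc (n k) v)) (z u)) -addrA.
    by apply: (submodD HN) => //; exact: YD.
  have [S [z' [hz /eqP]]] := pl_flat HH zu'.
  rewrite linearB subr_eq0 => /eqP Suv.
  have [x|T hT] := @Dstab k (S \o odds) z'; first by rewrite -(copair_odds z) /=; exact: hz.
  (* [theta] is linear and takes [u] to [D k v]; subtracting its contribution makes [S'] kill [u]
     and changes the represented element only by values of [Y k.+1] in the new domain. *)
  pose theta : {linear F -> F} := trunc (n k.+1) \o (T \o (S \o evens)).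
  have thetau : theta u = D k v by rewrite /= Suv -[X in T X]/((S \o odds) (D k v)) hT truncD.
  pose S' : {linear F -> F} := (S \o evens) \- (S \o (odds \o theta)).
  have S'E x : S' x = S (evens x) - S (odds (theta x)) by [].
  exists S', z'; split=> [x|]; last by rewrite S'E thetau Suv subrr.
  apply/domH'; exists k.+1, (T (S (evens x))).
  rewrite -[trunc _ _]/(theta x).
  have := submodB HN (hz (evens x)) (hz (odds (theta x))).
  rewrite copair_evens copair_odds; congr N.
  rewrite S'E (linearB z') !opprB !addrA.
  by congr (_ - _); rewrite addrAC.
Qed.

End Extension.

Lemma partial_lift_extension H (m : M) : partial_lift H ->
  exists H', [/\ partial_lift H', H `<=` H' & dom H' m].
Proof.
move=> HH; have HN := dom_submod (pl_submod HH).
(* The initial map sends every basis vector to [m]; in rank 1 it represents [m] as the value at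
   [e 0]. *)
have [Y [n [D [[Y0 n0] YD tD sD]]]] := stable_chain stab HN (flift (fun=> m)) 1.
have [H' [HH' sub dom']] := chain_extension HH YD tD sD.
exists H'; split=> //; have := dom' 0%N (e 0%N).
by rewrite Y0 n0 trunc_basis// flift_basis.
Qed.

Lemma maximal_partial_lift : eqflat M -> exists2 H, partial_lift H & forall m, dom H m.
Proof.
move=> fM.
have base : partial_lift [set 0 : (M * A)%type].
  split.
  - by split=> // a x y -> ->; rewrite scaler0 addr0.
  - by move=> m a [-> ->]; rewrite !linear0.
  - by move=> a [].
  - have -> // : dom [set 0 : (M * A)%type] = [set 0].
    by apply/seteqP; split=> [m [a [->]]//|m ->]; exists 0.
have [|H [PH maxH]] := @Zorn_bigcup _ (fun H : set (M * A)%type => H = set0 \/ partial_lift H).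
  move=> C CP Ctot; have [[X0 CX0 [q0 Xq0]]|noX] := pselect (exists2 X, C X & X !=set0);
    last first.
    left; apply/seteqP; split=> // q [X CX Xq]; case: noX; exists X => //; by exists q.
  have CPL X q : C X -> X q -> partial_lift X.
    by move=> /CP[->//|].
  right; split.
  - split=> [|a x y [X CX Xx] [Z CZ Zy]].
      by exists X0 => //; exact: (pl_submod (CPL _ _ CX0 Xq0)).1.
    have [XZ|ZX] := Ctot _ _ CX CZ.
      exists Z => //; apply: (pl_submod (CPL _ _ CZ Zy)).2 => //; exact: XZ.
    exists X => //; apply: (pl_submod (CPL _ _ CX Xx)).2 => //; exact: ZX.
  - by move=> m a [X CX Xq]; exact: (pl_lift (CPL _ _ CX Xq)).
  - by move=> a [X CX Xq]; exact: (pl_fun (CPL _ _ CX Xq)).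
  - move=> z u [a [X CX Xq]].
    have [|S [z' [hz Su]]] := @pl_flat _ (CPL _ _ CX Xq) z u; first by exists a.
    exists S, z'; split=> // x; have [b Xb] := hz x; by exists b, X.
have HH : partial_lift H.
  case: PH => // H0; case: (maxH [set 0]); last by right.
  by rewrite H0; split=> // /(_ 0); apply.
exists H => // m; have [H' [HH' sub domm]] := partial_lift_extension m HH.
have [sub'|nsub] := pselect (H' `<=` H).
  by case: domm => a /sub' Ha; exists a.
by case: (maxH H'); [split|right].
Qed.

End PartialLifts.

(** A partial lift defined on all of [M] is the graph of a lift, linear because the graph is a
    single-valued submodule. *)
Lemma stabilizing_projective (R : pzRingType) (M : lmodType R) :
  stabilizing R -> eqflat M -> projective M.
Proof.
move=> stab fM A B f g fsurj.
have [H HH domH] := maximal_partial_lift stab g fsurj fM.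
have [h hP] := choice domH; have [_ HP] := pl_submod HH.
have hlin : linear h.
  move=> a x y; apply: subr0_eq; apply: (pl_fun HH).
  have := submodB (pl_submod HH) (hP (a *: x + y)) (HP a _ _ (hP x) (hP y)).
  by congr H; apply/pair_equal_spec; rewrite /= subrr.
by exists (mklin hlin) => x; exact: (pl_lift HH (hP x)).
Qed.

(** * The equivalence *)

Section Perfect.
Variables (R : pzRingType) (I : Type).
Hypothesis Iinf : infinite_set [set: I].

Lemma perfect_summand_universal : left_perfect R ->
  universal (@summand_embedding R) (generated_flat I) (freemod R I).
Proof.
move=> perf M [genM /perf/projective_split/(_ genM)[f [g fg]]] _.
by exists f; exact: retraction_summand fg.
Qed.

Lemma perfect_elementary_universal : left_perfect R ->
  universal (@elementary_embedding R) (generated_flat_model I) (freemod R I).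
Proof.
move=> perf M [genM /perf/projective_split/(_ genM)[f [g fg]] mM] _; exists f.
by apply: model_elementary_embedding => //; exact: split_reflects fg.
Qed.

Lemma pure_universal_perfect :
  universal (@pure_embedding R) (generated_flat_model I) (freemod R I) -> left_perfect R.
Proof.
move=> /(pure_universal_stabilizing Iinf) stab M /flat_eqflat.
exact: stabilizing_projective.
Qed.

Lemma universal_mono
    (emb emb' : forall M N : lmodType R, {linear M -> N} -> Prop) (K K' : lmodType R -> Prop)
    (U : lmodType R) :
  (forall (M : lmodType R) (f : {linear M -> U}), emb M U f -> emb' M U f) ->
  (forall M, K' M -> K M) -> universal emb K U -> universal emb' K' U.
Proof. by move=> ee KK univ M /KK/univ h /h[f /ee]; exists f. Qed.

Lemma flat_model_flat (M : lmodType R) : generated_flat_model I M -> generated_flat I M.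
Proof. by case. Qed.

End Perfect.

Theorem theorem2 (R : pzRingType) :
  [<->
    (* (i), with elementary, pure and direct-summand embeddings *)
    exists2 I : Type, infinite_set [set: I] &
      universal (@elementary_embedding R) (generated_flat_model I) (freemod R I);
    forall I : Type, infinite_set [set: I] ->
      universal (@elementary_embedding R) (generated_flat_model I) (freemod R I);
    exists2 I : Type, infinite_set [set: I] &
      universal (@pure_embedding R) (generated_flat_model I) (freemod R I);
    forall I : Type, infinite_set [set: I] ->
      universal (@pure_embedding R) (generated_flat_model I) (freemod R I);
    exists2 I : Type, infinite_set [set: I] &
      universal (@summand_embedding R) (generated_flat_model I) (freemod R I);
    forall I : Type, infinite_set [set: I] ->
      universal (@summand_embedding R) (generated_flat_model I) (freemod R I);
    (* (ii), with pure and direct-summand embeddings *)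
    exists2 I : Type, infinite_set [set: I] &
      universal (@pure_embedding R) (generated_flat I) (freemod R I);
    forall I : Type, infinite_set [set: I] ->
      universal (@pure_embedding R) (generated_flat I) (freemod R I);
    exists2 I : Type, infinite_set [set: I] &
      universal (@summand_embedding R) (generated_flat I) (freemod R I);
    forall I : Type, infinite_set [set: I] ->
      universal (@summand_embedding R) (generated_flat I) (freemod R I);
    (* (iii) *)
    left_perfect R ].
Proof.
have elementary I : universal (@elementary_embedding R) (generated_flat_model I) (freemod R I) ->
    universal (@pure_embedding R) (generated_flat_model I) (freemod R I).
  by apply: universal_mono => // M f; exact: elementary_pure.
have summand I : universal (@summand_embedding R) (generated_flat_model I) (freemod R I) ->
    universal (@pure_embedding R) (generated_flat_model I) (freemod R I).
  by apply: universal_mono => // M f; exact: summand_pure.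
have pure_flat I : universal (@pure_embedding R) (generated_flat I) (freemod R I) ->
    universal (@pure_embedding R) (generated_flat_model I) (freemod R I).
  by apply: universal_mono => //; exact: flat_model_flat.
have summand_model I : universal (@summand_embedding R) (generated_flat I) (freemod R I) ->
    universal (@summand_embedding R) (generated_flat_model I) (freemod R I).
  by apply: universal_mono => //; exact: flat_model_flat.
have summand_flat I : universal (@summand_embedding R) (generated_flat I) (freemod R I) ->
    universal (@pure_embedding R) (generated_flat I) (freemod R I).
  by apply: universal_mono => // M f; exact: summand_pure.
have perfect I := @pure_universal_perfect R I.
have nat_inf := infinite_nat.
(* Apart from the step from elementary to pure embeddings, each implication starting from a
   universality condition first derives [left_perfect] from pure universality among the flat
   models. *)
tfae.
- by case=> I /perfect p /elementary/p pf J Jinf; exact: perfect_elementary_universal.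
- by move/(_ nat nat_inf)/elementary => h; exists nat.
- case=> I /perfect p /p pf J Jinf; apply: elementary.
  exact: perfect_elementary_universal.
- move/(_ nat nat_inf)/(perfect _ nat_inf) => pf; exists nat => //.
  exact/summand_model/perfect_summand_universal.
- case=> I /perfect p /summand/p pf J Jinf.
  exact/summand_model/perfect_summand_universal.
- move/(_ nat nat_inf)/summand/(perfect _ nat_inf) => pf; exists nat => //.
  exact/summand_flat/perfect_summand_universal.
- case=> I /perfect p /pure_flat/p pf J Jinf.
  exact/summand_flat/perfect_summand_universal.
- move/(_ nat nat_inf)/pure_flat/(perfect _ nat_inf) => pf; exists nat => //.
  exact: perfect_summand_universal.
- by case=> I /perfect p /summand_model/summand/p pf J Jinf; exact: perfect_summand_universal.
- by move/(_ nat nat_inf)/summand_model/summand/(perfect _ nat_inf).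
- by move=> pf; exists nat => //; exact: perfect_elementary_universal.
Qed.
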